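(* Let $k$ be a field, $R=k[x,y,z]$ with the standard grading, and let $s\geq 3$ be an integer. Let $I\subset R$ be a homogeneous ideal of grade $3$ such that $R/I$ is compressed with $\operatorname{Soc}(R/I)\cong k(-s)\oplus k(-2s+1)$. Then $R/I$ has Tor algebra class $G(r)$ for some $s\leq r\leq 2s-1$.
   Context: The socle isomorphism is as graded vector spaces: one basis element in degree $s$ and one in degree $2s-1$. $R/I$ compressed means: with $c_\ell=\dim_k \operatorname{Soc}(R/I)_\ell$, $\dim_k (R/I)_i=\min\{\binom{2+i}{i},\ \sum_{\ell=0}^{2s-1} c_\ell\binom{2+\ell-i}{\ell-i}\}$ for $0\le i\le 2s-1$, where binomials with $\ell<i$ are $0$. Tor algebra class: for a homogeneous ideal $I\subseteq R_+^2$ with $\operatorname{pd}_R(R/I)=3$, let $T_\bullet=\operatorname{Tor}_\bullet^R(R/I,k)$ with its graded-commutative algebra structure, $m=\mu(I)$ the minimal number of generators, and $t$ the type of $R/I$. $R/I$ has Tor algebra class $G(r)$ ($r\geq 2$) if there exist bases $e_1,\dots,e_m$ of $T_1$, $f_1,\dots,f_{m+t-1}$ of $T_2$, $g_1,\dots,g_t$ of $T_3$ such that the only nonzero products of basis elements of positive degree are $e_if_i=g_1=f_ie_i$ for $1\leq i\leq r$ (so $T_1\cdot T_1=0$, $\operatorname{rank}_k(T_1\cdot T_2)=1$, and the map $T_2\to\operatorname{Hom}_k(T_1,T_3)$ has rank $r$). *)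

(* Defs.v *)
From HB Require Import structures.
From mathcomp Require Import all_boot all_order all_algebra.
From mathcomp Require Export ring_quotient mpoly.
Set Implicit Arguments.
Unset Strict Implicit.
Unset Printing Implicit Defensive.
Import GRing.Theory.
Local Open Scope ring_scope.

(* An ideal I of k[x,y,z] is a collective predicate satisfying MathComp's      *)
(* [idealr_closed] (which includes 1 \notin I).  The modules R/I, Soc(R/I) and *)
(* Tor_p(R/I,k) are subquotients of free R-modules, handled through            *)
(* representatives: the quotient of a subspace V by a subspace W.              *)

(* The classes of b_0, ..., b_(n-1), all in V, form a k-basis of the image of  *)
(* V in M/W, i.e., of (V + W)/W = V/(V :&: W).                                 *)
Definition basis_mod (k : fieldType) (M : lmodType k) (V W : M -> Prop)
    (n : nat) (b : 'I_n -> M) : Prop :=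
  [/\ forall i, V (b i),
      forall v, V v -> exists c : 'I_n -> k, W (v - \sum_i c i *: b i)
    & forall c : 'I_n -> k, W (\sum_i c i *: b i) -> forall i, c i = 0].

Definition has_dim_mod (k : fieldType) (M : lmodType k) (V W : M -> Prop)
    (n : nat) : Prop :=
  exists b : 'I_n -> M, basis_mod V W b.

Definition homogeneous_ideal (k : fieldType) (I : {pred {mpoly k[3]}}) : Prop :=
  forall d p, p \in I -> pihomog mdeg d p \in I.

(* R_+ = (x, y, z) *)
Definition in_Rplus (k : fieldType) (p : {mpoly k[3]}) : Prop := p@_0%MM = 0.

Definition in_Rplus2 (k : fieldType) (p : {mpoly k[3]}) : Prop :=
  exists n (a b : 'I_n -> {mpoly k[3]}),
    (forall i, in_Rplus (a i) /\ in_Rplus (b i)) /\ p = \sum_i a i * b i.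

(* p belongs to the ideal generated by the entries of a *)
Definition in_span (k : fieldType) (a : seq {mpoly k[3]}) (p : {mpoly k[3]})
    : Prop :=
  exists c : 'I_(size a) -> {mpoly k[3]}, p = \sum_i c i * a`_i.

Definition regular_seq (k : fieldType) (a : seq {mpoly k[3]}) : Prop :=
  (forall i, (i < size a)%N ->
     forall p, in_span (take i a) (a`_i * p) -> in_span (take i a) p)
  /\ ~ in_span a 1.

Definition has_grade (k : fieldType) (I : {pred {mpoly k[3]}}) (g : nat)
    : Prop :=
  (exists a, [/\ size a = g, {subset a <= I} & regular_seq a])
  /\ (forall a, {subset a <= I} -> regular_seq a -> (size a <= g)%N).

Definition generates (k : fieldType) (a : seq {mpoly k[3]})
    (I : {pred {mpoly k[3]}}) : Prop :=
  forall p, p \in I <-> in_span a p.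

(* mu(I) = m *)
Definition min_num_gens (k : fieldType) (I : {pred {mpoly k[3]}}) (m : nat)
    : Prop :=
  (exists a, size a = m /\ generates a I)
  /\ (forall a, generates a I -> (m <= size a)%N).

(* The class of p lies in Soc(R/I) = (0 :_{R/I} R_+) *)
Definition in_socle (k : fieldType) (I : {pred {mpoly k[3]}})
    (p : {mpoly k[3]}) : Prop :=
  forall q, in_Rplus q -> q * p \in I.

(* dim_k Soc(R/I) = t *)
Definition has_type (k : fieldType) (I : {pred {mpoly k[3]}}) (t : nat)
    : Prop :=
  has_dim_mod (in_socle I) (fun p => p \in I) t.

(* Soc(R/I) is isomorphic to the direct sum of the k(-d), d <- ds, as a graded *)
(* vector space.                                                               *)
Definition socle_iso (k : fieldType) (I : {pred {mpoly k[3]}}) (ds : seq nat)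
    : Prop :=
  exists b : 'I_(size ds) -> {mpoly k[3]},
    (forall i, b i \is (nth 0%N ds i).-homog)
    /\ basis_mod (in_socle I) (fun p => p \in I) b.

(* dim_k (R/I)_i = d *)
Definition has_hilb (k : fieldType) (I : {pred {mpoly k[3]}}) (i d : nat)
    : Prop :=
  has_dim_mod (fun p : {mpoly k[3]} => p \is i.-homog) (fun p => p \in I) d.

(* dim_k Soc(R/I)_l = c *)
Definition has_socle_dim (k : fieldType) (I : {pred {mpoly k[3]}}) (l c : nat)
    : Prop :=
  has_dim_mod (fun p : {mpoly k[3]} => p \is l.-homog /\ in_socle I p)
    (fun p => p \in I) c.

(* R/I is compressed, with top socle degree e.  Restricting the sum to l >= i  *)
(* implements the convention that the binomials with l < i vanish.             *)
Definition compressed (k : fieldType) (I : {pred {mpoly k[3]}}) (e : nat)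
    : Prop :=
  exists c : nat -> nat,
    (forall l, (l <= e)%N -> has_socle_dim I l (c l))
    /\ (forall i, (i <= e)%N ->
          has_hilb I i
            (minn 'C(2 + i, i)
               (\sum_(0 <= l < e.+1 | i <= l) c l * 'C(2 + (l - i), l - i)))%N).

(* The Koszul complex K on x, y, z, as a DG algebra: the exterior algebra over *)
(* R with basis e_S = e_{s_1} /\ ... /\ e_{s_p}, for S = {s_1 < ... < s_p}; an  *)
(* element is the family of its coordinates on the e_S.                        *)
Notation koszul k := {ffun {set 'I_3} -> {mpoly k[3]}}.

(* e_T /\ e_U = (-1)^(inversions T U) e_(T :|: U) if T and U are disjoint *)
Definition inversions (T U : {set 'I_3}) : nat :=
  #|[set ij : 'I_3 * 'I_3 | [&& ij.1 \in T, ij.2 \in U & (ij.2 < ij.1)%N]]|.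

Definition koszul_mul (k : fieldType) (u v : koszul k) : koszul k :=
  [ffun S : {set 'I_3} => \sum_(T : {set 'I_3} | T \subset S)
     (-1) ^+ inversions T (S :\: T) * u T * v (S :\: T)].

(* d e_S = \sum_(i in S) (-1)^#{j in S | j < i} x_i e_(S :\ i), transposed to  *)
(* coordinates.                                                                *)
Definition koszul_d (k : fieldType) (u : koszul k) : koszul k :=
  [ffun S : {set 'I_3} => \sum_(i | i \notin S)
     (-1) ^+ #|[set j in S | (j < i)%N]| * 'X_i * u (i |: S)].

Definition koszul_deg (k : fieldType) (p : nat) (u : koszul k) : Prop :=
  forall S : {set 'I_3}, #|S| != p -> u S = 0.

(* Since K is a DG algebra resolution of k, Tor^R(R/I,k) is the homology       *)
(* algebra of K/IK.  A p-cycle of K/IK is represented by u in K_p with         *)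
(* du in IK; it is a boundary when u lies in dK_(p+1) + IK.                    *)
Definition tor_cycle (k : fieldType) (I : {pred {mpoly k[3]}}) (p : nat)
    (u : koszul k) : Prop :=
  koszul_deg p u /\ forall S, koszul_d u S \in I.

Definition tor_boundary (k : fieldType) (I : {pred {mpoly k[3]}}) (p : nat)
    (u : koszul k) : Prop :=
  koszul_deg p u /\
  exists v, koszul_deg p.+1 v /\ forall S, (u - koszul_d v) S \in I.

Definition tor_eq (k : fieldType) (I : {pred {mpoly k[3]}}) (p : nat)
    (u v : koszul k) : Prop :=
  tor_boundary I p (u - v).

Definition tor_basis (k : fieldType) (I : {pred {mpoly k[3]}}) (p n : nat)
    (b : 'I_n -> koszul k) : Prop :=
  basis_mod (tor_cycle I p) (tor_boundary I p) b.

(* Tor algebra class G(r) of R/I, for I contained in R_+^2.  The requirement   *)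
(* pd_R(R/I) = 3 amounts to Tor_3 <> 0, which holds because g_1 exists.        *)
(* Products of basis elements of positive degree other than those listed have  *)
(* degree at least 4, where Tor vanishes.  The indices are shifted to start    *)
(* at 0.                                                                       *)
Definition tor_class_G (k : fieldType) (I : {pred {mpoly k[3]}}) (r : nat)
    : Prop :=
  [/\ (2 <= r)%N,
      forall p, p \in I -> in_Rplus2 p
    & exists (m t : nat) (e : 'I_m -> koszul k) (f : 'I_(m + t - 1) -> koszul k)
             (g : 'I_t -> koszul k) (g1 : 'I_t),
      [/\ [/\ min_num_gens I m, has_type I t, g1 = 0%N :> nat,
              (r <= m)%N & (r <= m + t - 1)%N],
          [/\ tor_basis I 1 e, tor_basis I 2 f & tor_basis I 3 g],
          forall i j, tor_eq I 2 (koszul_mul (e i) (e j)) 0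
        & forall (i : 'I_m) (j : 'I_(m + t - 1)),
            let c := if (i == j :> nat) && (i < r)%N then g g1 else 0 in
            tor_eq I 3 (koszul_mul (e i) (f j)) c
            /\ tor_eq I 3 (koszul_mul (f j) (e i)) c]].

(* Main.v *)
From HB Require Import structures.
Require Import Defs.
From mathcomp Require Import all_boot all_order all_algebra.
From mathcomp Require Import zify ring.
From Stdlib Require Import Classical.
Set Implicit Arguments.
Unset Strict Implicit.
Unset Printing Implicit Defensive.
Import GRing.Theory.
Local Open Scope ring_scope.

(* Let A = R/I.  Since dim A_(2s-1) = 1, the top socle element defines a
   functional phi on R that kills I and lives in degree 2s-1.  The Hilbert
   function makes I zero below degree s, dim I_s = s, and makes phi identify A_n
   with the dual of R_(2s-1-n) for n >= s+1, with A_s -> (R_(s-1))^* onto.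

   Koszul exactness of R and its dual then show that Tor_1 and Tor_2 are
   represented by Koszul cycles with coefficients in degrees s-1 and s only.  For
   s >= 3, degrees force T_1 T_1 = 0 and T_1 T_2 into the line of the top socle
   element, so the class is G(r) with r the rank of the form phi(u . w) on
   T_1 x T_2: bases are obtained by Gaussian elimination, and dim T_2 is the
   Euler characteristic of the Koszul complex of A.

   Duality shows that the form is nondegenerate on the degree s part of T_1, which
   is I_s; hence s <= r.  By degrees, r <= dim I_s + q, where q is the number of
   linear syzygies of I_s, and it remains to see that q < s.  Evaluating the
   linear syzygies at a generic point P gives vectors orthogonal to
   (v_1(P), ..., v_s(P)) <> 0, where v is a basis of I_s; so if q >= s, some
   combination of the syzygies vanishes at P.  It has the form X x w with w a
   multiple of P modulo X, i.e. w = h P, where h is killed, modulo I, by the linear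
   forms through P.  Then g |-> phi(g h) is proportional to evaluation at P in
   degree s; since it kills v_1 and v_1(P) <> 0, it vanishes, so h = 0. *)

(** With a one-dimensional socle, [phi] would make R/I self-dual. Here [b0] spoils this in one place
    only: in the pairing of degree s with degree s-1, its line is the radical on the degree s side,
    while the pairings of the other complementary degrees are perfect. The two halves of the
    nondegeneracy have different sources. An element of order above s that [phi] does not detect is
    pushed by the variables into I and so lies in the socle; on the other side, a dimension count in
    degree s settles R_(s-1), and powers of x carry this down to lower degrees.

    The bound q < s needs a point where some form in I_s does not vanish, and over a small field
    there may be no rational one. So P is the point (x, y, z) over the fraction field K of R, where
    evaluating a polynomial returns that polynomial. The price is that [phi], its nondegeneracy and
    the independence of the syzygies must be extended to K. The upper end of the interval is s +
    (s-1). *)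

(** * Exactness of the Koszul complex of the polynomial ring *)

Section Monomials.
Variables (n : nat) (R : comNzRingType).
Implicit Types (p q : {mpoly R[n]}) (m : 'X_{1..n}) (i j : 'I_n).

Lemma mcoeffXM i p m :
  ('X_i * p)@_m = if m i == 0%N then 0 else p@_(m - U_(i)).
Proof.
have [mi0|mi] := eqVneq (m i) 0%N; last first.
  have le : (U_(i) <= m)%MM by rewrite lep1mP.
  by rewrite mulrC -{1}(submK le) addmC mcoeffMX.
apply/eqP; rewrite mcoeff_eq0; apply/negP.
rewrite mulrC (perm_mem (msuppMX _ _)) => /mapP[m' _ E].
by move: mi0; rewrite E mnmDE mnm1E eqxx.
Qed.

(** The terms free of ['X_i] are discarded and the others divided by ['X_i]. This is a linear left
    inverse of multiplication by ['X_i] that commutes with the other variables, which is all that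
    exactness of the Koszul complex requires. *)
Definition mdivX i p : {mpoly R[n]} :=
  \sum_(m : 'X_{1..n < msize p}) p@_(m + U_(i)) *: 'X_[m].

Lemma mcoeff_divX i p m : (mdivX i p)@_m = p@_(m + U_(i)).
Proof.
have [lt|ge] := ltnP (mdeg m) (msize p); first exact: (mcoeff_mpoly (fun m => p@_(m + U_(i)))).
rewrite [RHS]memN_msupp_eq0; last first.
  by apply: msize_mdeg_ge; rewrite mdegD (leq_trans ge) // leq_addr.
rewrite raddf_sum big1 //= => m' _; rewrite mcoeffZ mcoeffX.
case: eqP => [E|_]; last by rewrite mulr0.
by have := bmdeg m'; rewrite E ltnNge ge.
Qed.

Lemma mdivX_is_linear i : linear (mdivX i).
Proof.
by move=> a p q; apply/mpolyP=> m; rewrite mcoeffD mcoeffZ !mcoeff_divX mcoeffD mcoeffZ.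
Qed.
HB.instance Definition _ i :=
  GRing.isLinear.Build R {mpoly R[n]} {mpoly R[n]} _ (mdivX i) (mdivX_is_linear i).

Lemma mdivXK i p : mdivX i ('X_i * p) = p.
Proof.
apply/mpolyP=> m; rewrite mcoeff_divX mcoeffXM mnmDE mnm1E eqxx addn1 /=.
by rewrite addmK.
Qed.

Lemma mdivXC i j p : i != j -> mdivX i ('X_j * p) = 'X_j * mdivX i p.
Proof.
move=> ij; apply/mpolyP=> m; rewrite mcoeff_divX !mcoeffXM mnmDE mnm1E (negPf ij) addn0.
case: eqP => // mj; rewrite mcoeff_divX; congr (_@__).
apply/mnmP=> l; rewrite !mnmDE !mnmBE !mnmDE !mnm1E.
case: (eqVneq j l) => [<-|_]; first by rewrite (negPf ij) !addn0.
by rewrite !subn0.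
Qed.

End Monomials.

Notation i0 := (@Ordinal 3 0 isT).
Notation i1 := (@Ordinal 3 1 isT).
Notation i2 := (@Ordinal 3 2 isT).

Lemma ord3P (P : 'I_3 -> Prop) : P i0 -> P i1 -> P i2 -> forall i, P i.
Proof.
move=> P0 P1 P2 [[|[|[|//]]] lt]; [move: P0|move: P1|move: P2];
  by congr P; apply: val_inj.
Qed.

Lemma sum_ord3 (V : nmodType) (F : 'I_3 -> V) : \sum_i F i = F i0 + F i1 + F i2.
Proof.
rewrite !big_ord_recl big_ord0 addr0 addrA.
by congr (_ + _ + _); congr F; apply: val_inj.
Qed.

Section Vectors.
Variable A : comNzRingType.
Implicit Types u v w : {ffun 'I_3 -> A}.

Definition vec3 (a b c : A) : {ffun 'I_3 -> A} :=
  [ffun i : 'I_3 => if i == i0 then a else if i == i1 then b else c].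

Lemma vec3E (a b c : A) :
  (vec3 a b c i0 = a) * (vec3 a b c i1 = b) * (vec3 a b c i2 = c).
Proof. by rewrite !ffunE. Qed.

Lemma eq_vec3 u v : u i0 = v i0 -> u i1 = v i1 -> u i2 = v i2 -> u = v.
Proof. by move=> *; apply/ffunP; apply: ord3P. Qed.

Definition dot u v : A := u i0 * v i0 + u i1 * v i1 + u i2 * v i2.

Definition cross u v : {ffun 'I_3 -> A} :=
  vec3 (u i1 * v i2 - u i2 * v i1) (u i2 * v i0 - u i0 * v i2)
       (u i0 * v i1 - u i1 * v i0).

Definition scale3 (a : A) u : {ffun 'I_3 -> A} := [ffun i => a * u i].

Lemma dotC u v : dot u v = dot v u.
Proof. by rewrite /dot; ring. Qed.

Lemma dotDr u v w : dot u (v + w) = dot u v + dot u w.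
Proof. by rewrite /dot !ffunE; ring. Qed.

Lemma dotBr u v w : dot u (v - w) = dot u v - dot u w.
Proof. by rewrite /dot !ffunE; ring. Qed.

Lemma dot_crossr u v : dot u (cross u v) = 0.
Proof. by rewrite /dot /cross !vec3E; ring. Qed.

Lemma cross_scale u a : cross u (scale3 a u) = 0.
Proof. by apply: eq_vec3; rewrite /cross !ffunE /=; ring. Qed.

Lemma dot_cross_swap u v w : dot (cross u v) w = - dot v (cross u w).
Proof. by rewrite /dot /cross !vec3E; ring. Qed.

Lemma dot_scaler u v a : dot u (scale3 a v) = a * dot u v.
Proof. by rewrite /dot !ffunE; ring. Qed.

Lemma crossBr u v w : cross u (v - w) = cross u v - cross u w.
Proof. by apply: eq_vec3; rewrite /cross !ffunE /=; ring. Qed.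

Lemma crossDr u v w : cross u (v + w) = cross u v + cross u w.
Proof. by apply: eq_vec3; rewrite /cross !ffunE /=; ring. Qed.

End Vectors.

Section KoszulExact.
Variable F : idomainType.
Local Notation R := {mpoly F[3]}.
Implicit Types (u w : {ffun 'I_3 -> R}).

Definition Xv : {ffun 'I_3 -> R} := [ffun i => 'X_i].

Lemma XvE i : Xv i = 'X_i.
Proof. by rewrite ffunE. Qed.

Lemma mpolyXU_neq0 i : 'X_i != 0 :> R.
Proof. by apply/negP=> /eqP/mpolyP/(_ U_(i)%MM)/eqP; rewrite mcoeffX eqxx mcoeff0 oner_eq0. Qed.

(** Two of the minors involve [w i0]; divided by x they express the last two coordinates through the
    quotient of [w i0] by x. That x divides [w i0] itself is seen after multiplying by y. *)
Lemma cross_Xv_eq0 w : cross Xv w = 0 -> exists p, w = scale3 p Xv.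
Proof.
move/ffunP=> E; exists (mdivX i0 (w i0)).
have := E i1; have := E i2; rewrite !vec3E !ffunE => /eqP.
rewrite subr_eq0 => /eqP/(congr1 (mdivX i0)); rewrite mdivXK mdivXC // => E1 /eqP.
rewrite subr_eq0 eq_sym => /eqP/(congr1 (mdivX i0)); rewrite mdivXK mdivXC // => E2.
apply: eq_vec3; rewrite !ffunE; last 2 first.
- by rewrite E1 mulrC.
- by rewrite E2 mulrC.
apply: (mulfI (mpolyXU_neq0 i1)).
have := E i2; rewrite !vec3E !ffunE => /eqP; rewrite subr_eq0 => /eqP <-.
by rewrite E1; ring.
Qed.

(** [P q] is the part of [q] free of x. Applied to the relation, [P] leaves a syzygy of y and z,
    solved by division by y; the parts divisible by x supply the other two coordinates of the
    witness. *)
Lemma dot_Xv_eq0 u : dot Xv u = 0 -> exists w, u = cross Xv w.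
Proof.
rewrite /dot !XvE => E.
pose P (q : R) := q - 'X_i0 * mdivX i0 q.
have PX j q : i0 != j -> P ('X_j * q) = 'X_j * P q.
  by move=> ?; rewrite /P mdivXC //; ring.
have E0 : 'X_i1 * P (u i1) = - ('X_i2 * P (u i2)).
  have: P ('X_i0 * u i0 + 'X_i1 * u i1 + 'X_i2 * u i2) = 0.
    by rewrite E /P linear0; ring.
  have PD a b : P (a + b) = P a + P b by rewrite /P linearD /=; ring.
  rewrite !PD (PX i1) // (PX i2) // {1}/P mdivXK subrr add0r => /eqP.
  by rewrite addr_eq0 => /eqP.
have E1 : P (u i1) = - ('X_i2 * mdivX i1 (P (u i2))).
  by rewrite -[LHS](mdivXK i1) E0 linearN /= mdivXC.
have E2 : 'X_i1 * mdivX i1 (P (u i2)) = P (u i2).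
  apply: (mulfI (mpolyXU_neq0 i2)).
  by apply: oppr_inj; rewrite -E0 E1; ring.
exists (vec3 (- mdivX i1 (P (u i2))) (mdivX i0 (u i2)) (- mdivX i0 (u i1))).
have E3 : u i0 = - ('X_i1 * mdivX i0 (u i1)) - 'X_i2 * mdivX i0 (u i2).
  rewrite -[LHS](mdivXK i0).
  have -> : 'X_i0 * u i0 = - ('X_i1 * u i1) - 'X_i2 * u i2.
    by rewrite -[LHS]subr0 -E; ring.
  by rewrite linearB linearN /= !mdivXC.
apply: eq_vec3; rewrite /cross !vec3E !XvE.
- by rewrite {1}E3; ring.
- rewrite mulrN -E1 /P; ring.
- rewrite mulrN E2 /P; ring.
Qed.

End KoszulExact.

(** * Bases of subquotients *)

Section LinearAlgebra.
Variable F : fieldType.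

Definition subspace (M : lmodType F) (Q : M -> Prop) : Prop :=
  Q 0 /\ forall a u v, Q u -> Q v -> Q (a *: u + v).

Section Subspace.
Variables (M : lmodType F) (Q : M -> Prop) (sQ : subspace Q).

Lemma subspace0 : Q 0. Proof. by case: sQ. Qed.

Lemma subspaceZ a u : Q u -> Q (a *: u).
Proof. by move=> Qu; rewrite -[_ *: _]addr0; apply: sQ.2 => //; apply: subspace0. Qed.

Lemma subspaceD u v : Q u -> Q v -> Q (u + v).
Proof. by move=> Qu Qv; rewrite -[u]scale1r; apply: sQ.2. Qed.

Lemma subspaceB u v : Q u -> Q v -> Q (u - v).
Proof. by move=> Qu Qv; rewrite addrC -scaleN1r; apply: sQ.2. Qed.

Lemma subspace_sum n (u : 'I_n -> M) : (forall i, Q (u i)) -> Q (\sum_i u i).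
Proof.
by move=> Qu; elim/big_rec: _ => [|i v _ Qv]; [apply: subspace0 | apply: subspaceD].
Qed.

Lemma subspace_comb n (c : 'I_n -> F) (u : 'I_n -> M) :
  (forall i, Q (u i)) -> Q (\sum_i c i *: u i).
Proof. by move=> Qu; apply: subspace_sum => i; apply: subspaceZ. Qed.

End Subspace.

Definition to_linear (U V : lmodType F) (f : U -> V) (lf : linear f) :
  {linear U -> V} := HB.pack f (GRing.isLinear.Build F U V _ f lf).

Lemma ltn_dependent m n (C : 'M[F]_(m, n)) :
  (n < m)%N -> exists2 z : 'rV_m, z != 0 & z *m C = 0.
Proof.
move=> lt; have: kermx C != 0.
  by rewrite kermx_eq0 /row_free neq_ltn (leq_ltn_trans (rank_leq_col C)).
by case/rowV0Pn=> z /sub_kermxP zC z0; exists z.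
Qed.

(** [H] is any set of vectors, not a subspace, and the free family is drawn from [H] itself: this is
    what later keeps bases homogeneous. The family grows greedily, with [d] bounding the missing
    rank. *)
Lemma extract_free n (H : 'rV[F]_n -> Prop) :
  exists r (B : 'M[F]_(r, n)),
    [/\ row_free B, forall i, H (row i B) & forall v, H v -> (v <= B)%MS].
Proof.
suff step d : forall r (B : 'M[F]_(r, n)), row_free B -> (forall i, H (row i B)) ->
    (n - r <= d)%N -> exists r (B : 'M[F]_(r, n)),
    [/\ row_free B, forall i, H (row i B) & forall v, H v -> (v <= B)%MS].
  by apply: (step n 0%N 0); [rewrite /row_free mxrank0 | case | rewrite subn0].
elim: d => [|d IH] r B fB HB.
  rewrite leqn0 subn_eq0 => le; exists r, B; split=> // v _; apply: submx_full.
  rewrite /row_full; move: fB; rewrite /row_free => /eqP rB.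
  by rewrite eqn_leq rank_leq_col rB.
move=> le; case: (classic (exists2 v, H v & ~~ (v <= B)%MS)) => [[v Hv nv]|no]; last first.
  exists r, B; split=> // v Hv; apply: contraT => nv; case: no; by exists v.
have lt: (B < B + v)%MS by rewrite /ltmx addsmxSl addsmx_sub submx_refl.
have rk : (\rank B < \rank (B + v))%N by exact: rank_ltmx.
apply: (IH (r + 1)%N (col_mx B v)).
- move: fB rk; rewrite /row_free => /eqP -> rk; rewrite eqn_leq rank_leq_row.
  by rewrite -addsmxE addn1.
- move=> i; case: (split_ordP i) => j ->; first by rewrite rowKu.
  by rewrite rowKd ord1 row_id.
- by rewrite addn1 subnS; case: (n - r)%N le.
Qed.

(* Fredholm alternative: a linear form lies in the span of a family as soon as
   it vanishes on everything the family annihilates. *)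
Lemma fredholm (G : lmodType F) (P : G -> Prop) n (b : {linear G -> 'rV[F]_n})
    (l : 'rV[F]_n) :
  subspace P ->
  (forall c : 'cV_n, (forall g, P g -> b g *m c = 0) -> l *m c = 0) ->
  exists2 g, P g & b g = l.
Proof.
move=> sP ann.
have [r [B [_ HB sB]]] := extract_free (fun v => exists2 g, P g & b g = v).
have {HB} [g Hg] := fin_all_exists2 HB.
(* The columns of [cokermx B] annihilate the span of [B], hence all values of [b] on [P], so by
   hypothesis they annihilate [l]. *)
have: (l <= B)%MS.
  rewrite submxE; apply/eqP/matrixP=> i j.
  have /matrixP/(_ i 0): l *m (cokermx B *m delta_mx j (0 : 'I_1)) = 0.
    apply: ann => h Ph; have /sB : exists2 g, P g & b g = b h by exists h.
    by rewrite submxE mulmxA => /eqP ->; rewrite mul0mx.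
  by rewrite mulmxA -colE !mxE.
case/submxP=> D ->; move=> bg; exists (\sum_i D 0 i *: g i).
  exact: subspace_comb.
by rewrite linear_sum mulmx_sum_row; apply: eq_bigr => i _; rewrite linearZ /= bg.
Qed.

Lemma factor_mx (M : lmodType F) n p (sg : {linear M -> 'rV[F]_n})
    (g : {linear M -> 'rV[F]_p}) :
  (forall v, exists u, sg u = v) -> (forall u, sg u = 0 -> g u = 0) ->
  exists D : 'M[F]_(n, p), forall u, g u = sg u *m D.
Proof.
move=> surj ker.
have [e He] := fin_all_exists (fun i : 'I_n => surj (delta_mx 0 i)).
exists (\matrix_i g (e i)) => u.
pose u' := \sum_i sg u 0 i *: e i.
have su' : sg u' = sg u.
  rewrite linear_sum [RHS]row_sum_delta.
  by apply: eq_bigr => i _; rewrite linearZ /= He.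
have /ker : sg (u - u') = 0 by rewrite linearB /= su' subrr.
rewrite linearB /= => /eqP; rewrite subr_eq0 => /eqP ->.
rewrite linear_sum mulmx_sum_row; apply: eq_bigr => i _.
by rewrite linearZ /= rowK.
Qed.

Section BasisMod.
Variables (M : lmodType F) (V W : M -> Prop) (sV : subspace V) (sW : subspace W).

Lemma indep_mod_leq m n (b : 'I_n -> M) (c : 'I_m -> M) :
  basis_mod V W b -> (forall j, V (c j)) ->
  (forall z : 'I_m -> F, W (\sum_j z j *: c j) -> forall j, z j = 0) ->
  (m <= n)%N.
Proof.
move=> [Vb spb _] Vc indc; rewrite leqNgt; apply/negP=> lt.
have [C HC] := fin_all_exists (fun j => spb _ (Vc j)).
have [z z0 zC] := ltn_dependent (\matrix_(j, i) C j i) lt.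
case/negP: z0; apply/eqP/rowP=> j; rewrite mxE; apply: indc j.
have -> : \sum_j z 0 j *: c j = \sum_j z 0 j *: (c j - \sum_i C j i *: b i).
  under [RHS]eq_bigr do rewrite scalerBr; rewrite sumrB.
  apply/esym/eqP; rewrite subr_eq -subr_eq0 opprD addrA subrr add0r oppr_eq0.
  under eq_bigr do rewrite scaler_sumr.
  rewrite exchange_big /= big1 // => i _.
  under eq_bigr do rewrite scalerA.
  rewrite -scaler_suml; move/matrixP/(_ 0 i): zC; rewrite !mxE => E.
  suff -> : \sum_j z 0 j * C j i = 0 by rewrite scale0r.
  by rewrite -[RHS]E; apply: eq_bigr => j _; rewrite mxE.
exact: subspace_comb.
Qed.

Lemma basis_mod_size_uniq m n (b : 'I_n -> M) (c : 'I_m -> M) :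
  basis_mod V W b -> basis_mod V W c -> m = n.
Proof.
move=> bb bc; apply/eqP; rewrite eqn_leq; apply/andP; split.
  by case: (bc) => ? _ ?; apply: indep_mod_leq bb _ _.
by case: (bb) => ? _ ?; apply: indep_mod_leq bc _ _.
Qed.

Lemma basis_mod_change n (b : 'I_n -> M) (L : 'M[F]_n) :
  L \in unitmx -> basis_mod V W b ->
  basis_mod V W (fun i => \sum_j L i j *: b j).
Proof.
move=> uL [Vb spb indb].
have E (c : 'I_n -> F) : \sum_i c i *: (\sum_j L i j *: b j) =
    \sum_j ((\row_i c i) *m L) 0 j *: b j.
  under eq_bigr do rewrite scaler_sumr.
  rewrite exchange_big /=; apply: eq_bigr => j _.
  rewrite !mxE scaler_suml; apply: eq_bigr => i _.
  by rewrite mxE scalerA.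
split=> [i|v /spb[c Wc]|c].
- exact: subspace_comb.
- exists (fun i => ((\row_i c i) *m invmx L) 0 i); rewrite E.
  have -> : \row_i ((\row_i0 c i0) *m invmx L) 0 i = (\row_i c i) *m invmx L.
    by apply/rowP=> i; rewrite mxE.
  rewrite -mulmxA mulVmx // mulmx1.
  by under eq_bigr do rewrite mxE.
- rewrite E => /indb z i.
  have: (\row_i c i) *m L = 0 by apply/rowP=> j; rewrite z mxE.
  move/(congr1 (mulmx^~ (invmx L))); rewrite -mulmxA mulmxV // mulmx1 mul0mx.
  by move/rowP/(_ i); rewrite !mxE.
Qed.

End BasisMod.

Lemma eq_basis_mod (M : lmodType F) (V W V' W' : M -> Prop) n (b : 'I_n -> M) :
  (forall u, V u <-> V' u) -> (forall u, W u <-> W' u) ->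
  basis_mod V W b -> basis_mod V' W' b.
Proof.
move=> eV eW [Vb sb ib]; split=> [i|v /eV/sb[c /eW]|c /eW/ib //].
- exact/eV.
- by exists c.
Qed.

Lemma basis_mod_transport (M M' : lmodType F) (f : {linear M -> M'})
    (V' W' : M' -> Prop) n (b : 'I_n -> M) :
  (forall v, V' v -> exists u, v = f u) ->
  basis_mod (V' \o f) (W' \o f) b -> basis_mod V' W' (f \o b).
Proof.
move=> im [Vb sb ib].
have E (c : 'I_n -> F) : \sum_i c i *: (f \o b) i = f (\sum_i c i *: b i).
  by rewrite linear_sum; apply: eq_bigr => i _; rewrite linearZ.
split=> [//|v V'v|c].
  have [u def_v] := im v V'v; rewrite def_v in V'v *.
  have [c Wc] := sb u V'v; exists c; rewrite E -linearB; exact: Wc.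
by rewrite E => /ib.
Qed.

(** A Koszul cycle is, up to boundaries, a sum of two homogeneous cycles, one for each middle
    degree. This is why [V] is spanned by sums of two elements of [H], while the basis has to lie in
    [H]. *)
Lemma basis_mod_coords (M : lmodType F) n (t : {linear M -> 'rV[F]_n})
    (V H : M -> Prop) r (Z : 'M[F]_(r, n)) :
  (forall v, (v <= Z)%MS <-> exists2 u, V u & t u = v) ->
  (forall u, H u -> V u) ->
  (forall u, V u -> exists h h', [/\ H h, H h' & t u = t h + t h']) ->
  exists m (b : 'I_m -> M),
    [/\ m = \rank Z, forall i, H (b i) & basis_mod V (fun u => t u = 0) b].
Proof.
move=> imV HV spH.
have [m [B [fB HB sB]]] := extract_free (fun v => exists2 u, H u & t u = v).
have {HB} [b Hb tb] := fin_all_exists2 HB.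
have E (c : 'I_m -> F) : t (\sum_i c i *: b i) = (\row_i c i) *m B.
  rewrite linear_sum mulmx_sum_row; apply: eq_bigr => i _.
  by rewrite linearZ /= tb mxE.
have spB u : V u -> (t u <= B)%MS.
  case/spH=> h [h' [Hh Hh' ->]].
  by apply: addmx_sub; apply: sB; [exists h | exists h'].
exists m, b; split=> //.
  rewrite -(eqP fB); apply/eqP; rewrite eqn_leq; apply/andP; split.
    by apply/mxrankS/row_subP=> i; apply/imV; rewrite -tb; exists (b i) => //; apply: HV.
  apply/mxrankS/row_subP=> i; have /imV[u Vu <-] := row_sub i Z; exact: spB.
split=> [i|v /spB/submxP[D tv]|c].
- exact: HV.
- exists (fun i => D 0 i); rewrite linearB /= E tv.
  have -> : \row_i D 0 i = D by apply/rowP=> i; rewrite mxE.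
  by rewrite subrr.
- rewrite E => /eqP; rewrite mulmx_free_eq0 // => /eqP/rowP z i.
  by have := z i; rewrite !mxE.
Qed.

End LinearAlgebra.

(** * Graded pieces and truncations of polynomials *)

Section Graded.
Variable F : fieldType.
Local Notation R := {mpoly F[3]}.
Implicit Types (p q : R) (d e n : nat) (m : 'X_{1..3}).

Lemma mcoeff_pihomog d p m :
  (pihomog mdeg d p)@_m = if mdeg m == d then p@_m else 0.
Proof.
pose l := maxn (msize p) (mdeg m).+1.
rewrite (pihomogwE _ _ (k := l)) ?leq_maxl // big_mkcond /=.
pose E m' := if mdeg m' == d then p@_m' else 0.
rewrite -[RHS]/(E m) -(mcoeff_mpoly (k := l) E) ?leq_maxr //.
congr (_@__); apply: eq_bigr => m' _; rewrite /E.
by case: eqP => //; rewrite scale0r.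
Qed.

Lemma homogP0 d p : reflect (forall m, mdeg m != d -> p@_m = 0) (p \is d.-homog).
Proof.
apply: (iffP idP) => [hp m|E]; first exact: dhomog_nemf_coeff.
apply/dhomogP=> m; rewrite mcoeff_msupp => pm; apply/eqP.
by apply: contraNT pm => /E ->.
Qed.

Definition ord_ge n p : Prop := forall m, (mdeg m < n)%N -> p@_m = 0.

Lemma subspace_ord_ge n : subspace (ord_ge n).
Proof.
split=> [m _|a p q Hp Hq m lt]; first by rewrite mcoeff0.
by rewrite mcoeffD mcoeffZ Hp // Hq // mulr0 addr0.
Qed.

Lemma ord_geW n n' p : (n' <= n)%N -> ord_ge n p -> ord_ge n' p.
Proof. by move=> le Hp m lt; apply: Hp; apply: leq_trans le. Qed.

Lemma homog_ord_ge n d p : (n <= d)%N -> p \is d.-homog -> ord_ge n p.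
Proof.
by move=> le /homogP0 Hp m lt; apply: Hp; rewrite neq_ltn (leq_trans lt le).
Qed.

Lemma ord_geM n n' p q : ord_ge n p -> ord_ge n' q -> ord_ge (n + n') (p * q).
Proof.
move=> Hp Hq m lt; rewrite mcoeffM big1 // => -[m1 m2] /= /eqP Em.
have [l1|g1] := ltnP (mdeg m1) n; first by rewrite Hp ?mul0r.
rewrite Hq ?mulr0 //; have := congr1 mdeg Em; rewrite mdegD => E.
by rewrite -(ltn_add2l (mdeg m1)) -E (leq_trans lt) // leq_add2r.
Qed.

Lemma ord_ge_eq0 n p : ord_ge n p -> (msize p <= n)%N -> p = 0.
Proof.
move=> Hp le; apply/mpolyP=> m; rewrite mcoeff0.
have [/Hp //|ge] := ltnP (mdeg m) n.
by rewrite memN_msupp_eq0 // msize_mdeg_ge // (leq_trans le).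
Qed.

Definition trunc n p : R := \sum_(d < n) pihomog mdeg d p.

Lemma trunc_is_linear n : linear (trunc n).
Proof.
move=> a p q; rewrite /trunc scaler_sumr -big_split; apply: eq_bigr => d _.
by rewrite linearP.
Qed.
HB.instance Definition _ n :=
  GRing.isLinear.Build F R R _ (trunc n) (trunc_is_linear n).

Lemma mcoeff_trunc n p m : (trunc n p)@_m = if (mdeg m < n)%N then p@_m else 0.
Proof.
rewrite raddf_sum /=; case: ltnP => [lt|ge].
  rewrite (bigD1 (Ordinal lt)) //= mcoeff_pihomog eqxx big1 ?addr0 // => d ne.
  rewrite mcoeff_pihomog; case: eqP => // E; case/eqP: ne; exact: val_inj.
rewrite big1 // => d _; rewrite mcoeff_pihomog; case: eqP => // E.
by have := ltn_ord d; rewrite -E ltnNge ge.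
Qed.

Lemma trunc_ord_ge n p : ord_ge n p -> trunc n p = 0.
Proof.
move=> Hp; apply/mpolyP=> m; rewrite mcoeff_trunc mcoeff0.
by case: ifP => // lt; rewrite Hp.
Qed.

Lemma ord_ge_subtrunc n p : ord_ge n (p - trunc n p).
Proof. by move=> m lt; rewrite mcoeffB mcoeff_trunc lt subrr. Qed.

Lemma truncXM n i p : trunc n.+1 ('X_i * p) = 'X_i * trunc n p.
Proof.
apply/mpolyP=> m; rewrite mcoeff_trunc !mcoeffXM; case: eqP => mi.
  by case: ifP.
rewrite mcoeff_trunc; have le : (U_(i) <= m)%MM by rewrite lep1mP; apply/eqP.
by rewrite -{1}(submK le) mdegD mdeg1 addn1.
Qed.

Lemma pihomogM d e p q : q \is e.-homog ->
  pihomog mdeg (d + e) (p * q) = pihomog mdeg d p * q.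
Proof.
move=> hq; rewrite {1}(pihomog_partitionE (mf := mdeg) (leq_addr d.+1 (msize p))).
rewrite mulr_suml linear_sum /=.
have dl : (d < msize p + d.+1)%N by rewrite addnS ltnS leq_addl.
rewrite (bigD1 (Ordinal dl)) //= pihomog_dE; last first.
  by apply: dhomogM => //; apply: pihomogP.
rewrite big1 ?addr0 // => d' ne; apply: (pihomog_ne0 (d := (d' + e)%N)).
  by rewrite eqn_add2r; apply: contraNneq ne => E; apply/eqP/val_inj.
by apply: dhomogM => //; apply: pihomogP.
Qed.

Lemma pihomogXM d i p : pihomog mdeg d.+1 ('X_i * p) = 'X_i * pihomog mdeg d p.
Proof.
rewrite mulrC -[d.+1]addn1 pihomogM 1?mulrC // dhomogX.
by rewrite /= mdeg1.
Qed.

Lemma dhomogXU i : ('X_i : R) \is 1.-homog.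
Proof. by rewrite dhomogX /= mdeg1. Qed.

Lemma dhomogXn i n : ('X_i ^+ n : R) \is n.-homog.
Proof. by have := dhomogMn n (dhomogXU i); rewrite mul1n. Qed.

Lemma trunc_split n p : trunc n.+1 p = trunc n p + pihomog mdeg n p.
Proof. by rewrite /trunc big_ord_recr. Qed.

Lemma Rplus_decomp p : p@_0%MM = 0 ->
  exists u : {ffun 'I_3 -> R}, p = dot (Xv F) u.
Proof.
have homX0 (q : R) : exists u, q - (q@_0%MM)%:MP = dot (Xv F) u.
  elim/mpolyind: q => [|c m q _ _ [u Hu]].
    exists 0; rewrite mcoeff0 mpolyC0 subr0 /dot !ffunE; ring.
  have [u' Hu']: exists u', 'X_[m] - (('X_[m] : R)@_0%MM)%:MP = dot (Xv F) u'.
    have [->|/eqP m0] := m =P 0%MM.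
      by exists 0; rewrite mcoeffX eqxx mpolyX0 /dot !ffunE mpolyC1; ring.
    have [i mi] : exists i, m i != 0%N.
      apply: NNPP => no; case/eqP: m0; apply/mnmP => i; rewrite mnm0E.
      by apply/eqP/negPn/negP => mi; apply: no; exists i.
    exists [ffun j => if j == i then 'X_[m - U_(i)] else 0].
    rewrite mcoeffX (negPf m0) mpolyC0 subr0.
    have le : (U_(i) <= m)%MM by rewrite lep1mP.
    rewrite -{1}(submK le) mpolyXD /dot !ffunE.
    by elim/ord3P: i {mi le} => /=; ring.
  exists (u + scale3 c%:MP u'); rewrite dotDr dot_scaler -Hu -Hu'.
  rewrite mcoeffD mcoeffZ mpolyCD mpolyCM -!mul_mpolyC; ring.
by move=> p0; have := homX0 p; rewrite p0 mpolyC0 subr0.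
Qed.

End Graded.

(** Rank-nullity for the map from V to M/W. [Tm] expresses [B] through [b] modulo W and [Cm] lifts
    [b] back to [B]; from [Cm *m Tm = 1%:M] the rank of [Tm] is n, and its kernel gives the
    basis. *)
Lemma basis_mod_kernel (F : fieldType) (M : lmodType F) (V W : M -> Prop)
    N n (B : 'I_N -> M) (b : 'I_n -> M) :
  subspace V -> subspace W -> basis_mod V (fun p => p = 0) B -> basis_mod V W b ->
  exists v : 'I_(N - n) -> M, basis_mod (fun p => V p /\ W p) (fun p => p = 0) v.
Proof.
move=> sV sW [VB spB iB] [Vb spb ib].
have [T HT] := fin_all_exists (fun i => spb _ (VB i)).
have [C HC] := fin_all_exists (fun j => spB _ (Vb j)).
pose Tm := \matrix_(i, j) T i j; pose Cm := \matrix_(j, i) C j i.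
have modT (z : 'rV_N) : W (\sum_i z 0 i *: B i - \sum_j (z *m Tm) 0 j *: b j).
  have -> : \sum_j (z *m Tm) 0 j *: b j = \sum_i z 0 i *: \sum_j T i j *: b j.
    under [RHS]eq_bigr do rewrite scaler_sumr.
    rewrite exchange_big; apply: eq_bigr => j _; rewrite mxE scaler_suml.
    by apply: eq_bigr => i _; rewrite mxE scalerA.
  rewrite -sumrB; apply: subspace_sum => // i; rewrite -scalerBr.
  exact: subspaceZ.
have inW (z : 'rV_N) : W (\sum_i z 0 i *: B i) <-> z *m Tm = 0.
  split=> [Wz|z0].
    apply/rowP=> j; rewrite [RHS]mxE; apply: (ib (fun j => (z *m Tm) 0 j)).
    by rewrite -[X in W X](subKr (\sum_i z 0 i *: B i)); apply: subspaceB.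
  have := modT z; rewrite z0 [X in _ - X]big1 ?subr0 // => j _.
  by rewrite mxE scale0r.
have CT : Cm *m Tm = 1%:M.
  apply/row_matrixP=> j; rewrite row_mul; apply/rowP=> l.
  apply/eqP; rewrite -subr_eq0; apply/eqP.
  have -> : (row j Cm *m Tm) 0 l - row j 1%:M 0 l = (row j Cm *m Tm - row j 1%:M) 0 l.
    by rewrite [RHS]mxE [X in _ = _ + X]mxE.
  apply: (ib (fun l => (row j Cm *m Tm - row j 1%:M) 0 l)).
  have -> : \sum_i (row j Cm *m Tm - row j 1%:M) 0 i *: b i =
      \sum_i (row j Cm *m Tm) 0 i *: b i - b j.
    under eq_bigr do rewrite mxE [X in _ + X]mxE scalerBl.
    rewrite sumrB; congr (_ - _); rewrite (bigD1 j) //= !mxE eqxx scale1r.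
    by rewrite big1 ?addr0 // => i /negPf ne; rewrite !mxE eq_sym ne scale0r.
  have -> : b j = \sum_i (row j Cm) 0 i *: B i.
    apply/eqP; rewrite -subr_eq0; apply/eqP; rewrite -[RHS](HC j).
    by congr (_ - _); apply: eq_bigr => i _; rewrite !mxE.
  rewrite -opprB -scaleN1r; apply: subspaceZ => //; exact: modT.
have rT : \rank Tm = n.
  apply/eqP; rewrite eqn_leq rank_leq_col /=.
  by rewrite -{1}(mxrank1 F n) -CT mxrankM_maxr.
have rK : \rank (kermx Tm) = (N - n)%N by rewrite mxrank_ker rT.
rewrite -rK.
have [K [KT fK eK]] : exists K : 'M_(\rank (kermx Tm), N),
    [/\ K *m Tm = 0, row_free K & (K :=: kermx Tm)%MS].
  exists (row_base (kermx Tm)); rewrite row_base_free.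
  by split=> //; [apply/sub_kermxP; rewrite eq_row_base | apply: eq_row_base].
have E (c : 'I_(\rank (kermx Tm)) -> F) :
    \sum_i c i *: (\sum_l K i l *: B l) = \sum_l ((\row_i c i) *m K) 0 l *: B l.
  under eq_bigr do rewrite scaler_sumr.
  rewrite exchange_big; apply: eq_bigr => j _; rewrite mxE scaler_suml.
  by apply: eq_bigr => i _; rewrite mxE scalerA.
exists (fun i => \sum_l K i l *: B l); split=> [i|v [Vv Wv]|c].
- split; first exact: subspace_comb.
  have -> : \sum_l K i l *: B l = \sum_l row i K 0 l *: B l.
    by apply: eq_bigr => l _; rewrite mxE.
  by apply/inW; rewrite -row_mul KT row0.
- have [z /eqP] := spB _ Vv; rewrite subr_eq0 => /eqP def_v.
  have: (\row_i z i <= K)%MS.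
    rewrite eK; apply/sub_kermxP/inW.
    by under eq_bigr do rewrite mxE; rewrite -def_v.
  case/submxP=> D HD; exists (fun i => D 0 i); rewrite E.
  have -> : \row_i D 0 i = D by apply/rowP=> i; rewrite mxE.
  by rewrite -HD def_v; under [X in _ - X]eq_bigr do rewrite mxE; rewrite subrr.
- rewrite E => /iB z i.
  have : (\row_i c i) *m K == 0 by apply/eqP/rowP=> l; rewrite [RHS]mxE z.
  rewrite mulmx_free_eq0 // => /eqP/rowP/(_ i).
  by rewrite !mxE.
Qed.

Lemma dhomog_basis (F : fieldType) n d :
  exists B : 'I_('C(d + n, d)) -> {mpoly F[n.+1]},
    basis_mod (fun p : {mpoly F[n.+1]} => p \is d.-homog) (fun p => p = 0) B.
Proof.
have [f lf [g gK fK]] := dhomog_vecaxiom n F d.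
pose f' := to_linear lf.
pose b i := g (delta_mx 0 i).
have E (c : 'I_('C(d + n, d)) -> F) : f' (\sum_i c i *: b i) = \row_i c i.
  have fZ a x : f (a *: x) = a *: f x by exact: (linearZZ f').
  rewrite linear_sum; apply/rowP=> j.
  rewrite summxE (bigD1 j) //= big1 => [|i ne]; rewrite (fZ (c _)) fK !mxE eqxx.
    by rewrite eqxx mulr1 addr0.
  by rewrite eq_sym (negPf ne) mulr0.
have V (c : 'I_('C(d + n, d)) -> F) :
    mpoly_of_dhomog (\sum_i c i *: b i) = \sum_i c i *: mpoly_of_dhomog (b i).
  by rewrite linear_sum /=; apply: eq_bigr => i _; exact: linearZ.
exists (fun i => mpoly_of_dhomog (b i)); split=> [i|p hp|c].
- exact: dhomog_is_dhomog.
- exists (fun i => f (DHomog hp) 0 i); rewrite -V.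
  have /(can_inj gK) -> : f (\sum_i f (DHomog hp) 0 i *: b i) = f (DHomog hp).
    by rewrite -[f]/(f' : _ -> _) E; apply/rowP=> i; rewrite mxE.
  by rewrite subrr.
- rewrite -V => z i; have: \sum_i c i *: b i = 0 by apply: val_inj.
  by move/(congr1 f'); rewrite E linear0 => /rowP/(_ i); rewrite !mxE.
Qed.

Lemma sum_delta_nat n a (P : pred nat) (f : nat -> nat) :
  (\sum_(0 <= l < n | P l) (l == a) * f l = ((a < n) && P a) * f a)%N.
Proof.
rewrite big_mkcond; have [lt|ge] /= := ltnP a n.
  rewrite (bigD1_seq a) ?iota_uniq ?mem_index_iota //= eqxx.
  rewrite big1 ?addn0 => [|l /negPf ->]; last by case: ifP.
  by case: (P a).
rewrite big_nat big1 // => l /andP[_ lt]; rewrite (_ : l == a = false) ?if_same //.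
by apply/negbTE; rewrite neq_ltn (leq_trans lt ge).
Qed.

(** * Hilbert function and socle *)

Section HomogeneousIdeal.
Variables (k : fieldType) (I : {pred {mpoly k[3]}}).
Hypotheses (idI : idealr_closed I) (homI : homogeneous_ideal I).
Local Notation R := {mpoly k[3]}.
Implicit Types p q : R.

Lemma ideal0 : 0 \in I. Proof. by case: idI. Qed.

Lemma ideal_mull a p : p \in I -> a * p \in I.
Proof. by move=> Ip; rewrite -[_ * _]addr0; case: idI => I0 _; apply. Qed.

Lemma ideal_mulr a p : p \in I -> p * a \in I.
Proof. by rewrite mulrC; apply: ideal_mull. Qed.

Lemma subspace_ideal : subspace (fun p => p \in I).
Proof.
split=> [|a u v Iu Iv]; first exact: ideal0.
by rewrite -mul_mpolyC; case: idI => _ _; apply.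
Qed.

Lemma idealD p q : p \in I -> q \in I -> p + q \in I.
Proof. exact: (subspaceD subspace_ideal). Qed.

Lemma idealB p q : p \in I -> q \in I -> p - q \in I.
Proof. exact: (subspaceB subspace_ideal). Qed.

Lemma idealN p : p \in I -> - p \in I.
Proof. by rewrite -sub0r; apply: idealB; apply: ideal0. Qed.

Lemma idealZ a p : p \in I -> a *: p \in I.
Proof. exact: (subspaceZ subspace_ideal). Qed.

Lemma ideal_subl p q : p - q \in I -> q \in I -> p \in I.
Proof. by move=> Ipq Iq; rewrite -(subrK q p); apply: idealD. Qed.

Lemma ideal_trunc n p : p \in I -> trunc n p \in I.
Proof. by move=> Ip; apply: (subspace_sum subspace_ideal) => i; apply: homI. Qed.

Lemma in_socleXP p : in_socle I p <-> forall i, 'X_i * p \in I.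
Proof.
split=> [soc i|soc q q0].
  by apply: soc; rewrite /in_Rplus mcoeffX mnm1_eq0.
have [u ->] := Rplus_decomp q0; rewrite /dot !mulrDl.
rewrite !XvE -!mulrA ![u _ * p]mulrC !mulrA.
by apply: idealD; [apply: idealD|]; apply: ideal_mulr.
Qed.

Lemma ideal_dot (u v : {ffun 'I_3 -> R}) : (forall i, v i \in I) -> dot u v \in I.
Proof.
by move=> Iv; apply: idealD; [apply: idealD|]; apply: ideal_mull.
Qed.

End HomogeneousIdeal.

Section Core.
Variables (k : fieldType) (s : nat) (I : {pred {mpoly k[3]}}).
Hypotheses (s3 : (3 <= s)%N) (idI : idealr_closed I) (homI : homogeneous_ideal I).
Hypothesis compI : compressed I (2 * s - 1).
Local Notation R := {mpoly k[3]}.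
Local Notation top := (2 * s - 1)%N.
Implicit Types p q : R.

Variables b0 b1 : R.
Hypotheses (hb0 : b0 \is s.-homog) (hb1 : b1 \is top.-homog).
Hypotheses (sb0 : in_socle I b0) (sb1 : in_socle I b1).
Hypothesis soc_span : forall p, in_socle I p ->
  exists c0 c1, p - (c0 *: b0 + c1 *: b1) \in I.
Hypothesis soc_indep : forall c0 c1, c0 *: b0 + c1 *: b1 \in I -> c0 = 0 /\ c1 = 0.

Lemma subspace_homog d : subspace (fun p : R => p \is d.-homog).
Proof.
split=> [|a u v hu hv]; first exact: dhomog0.
by apply: dhomogD => //; apply: dhomogZ.
Qed.

Lemma pihomog_b d c0 c1 :
  pihomog mdeg d (c0 *: b0 + c1 *: b1) =
  (if d == s then c0 *: b0 else 0) + (if d == top then c1 *: b1 else 0).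
Proof.
rewrite linearD !linearZ /=; congr (_ + _).
  case: eqP => [->|/eqP ne]; first by rewrite pihomog_dE.
  by rewrite (pihomog_ne0 (d := s)) ?scaler0 // eq_sym.
case: eqP => [->|/eqP ne]; first by rewrite pihomog_dE.
by rewrite (pihomog_ne0 (d := top)) ?scaler0 // eq_sym.
Qed.

Lemma neq_s_top : s == top = false. Proof. by lia. Qed.

Lemma soc_homog p d : p \is d.-homog -> in_socle I p ->
  exists c0 c1, p - ((if d == s then c0 *: b0 else 0) +
                     (if d == top then c1 *: b1 else 0)) \in I.
Proof.
move=> hp /soc_span[c0 [c1 /(homI d)]]; rewrite linearB /= pihomog_dE // pihomog_b.
by exists c0, c1.
Qed.

Lemma soc_dimE l c : has_socle_dim I l c -> c = ((l == s) + (l == top))%N.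
Proof.
case=> b bb.
suff [b' bb'] : exists b' : 'I_((l == s) + (l == top)) -> R,
    basis_mod (fun p => p \is l.-homog /\ in_socle I p) (fun p => p \in I) b'.
  exact: basis_mod_size_uniq (subspace_ideal idI) _ _ _ _ bb' bb.
have [->|ls] := eqVneq l s.
  rewrite neq_s_top addn0; exists (fun=> b0); split=> // [p [hp /(soc_homog hp)]|c'].
    rewrite eqxx neq_s_top => -[c0 [_ H]]; exists (fun=> c0).
    by rewrite big_ord1 -[_ *: _]addr0.
  rewrite big_ord1 -[_ *: _]addr0 -(scale0r b1) => /soc_indep[c0 _] i.
  by rewrite ord1.
have [->|lt] := eqVneq l top.
  exists (fun=> b1); split=> // [p [hp /(soc_homog hp)]|c'].
    rewrite eqxx eq_sym neq_s_top => -[_ [c1 H]]; exists (fun=> c1).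
    by rewrite big_ord1 -[_ *: _]add0r.
  rewrite big_ord1 -[_ *: _]add0r -(scale0r b0) => /soc_indep[_ c1] i.
  by rewrite ord1.
exists (fun=> 0); split=> [[]|p [hp /(soc_homog hp)]|c' _ []] //.
rewrite (negPf ls) (negPf lt) => -[_ [_ H]]; exists (fun=> 0).
by rewrite big_ord0 -[X in _ - X]addr0.
Qed.

Lemma hilbE i : (i <= top)%N ->
  has_hilb I i (minn 'C(2 + i, i)
    ((i <= s) * 'C(2 + (s - i), s - i) + 'C(2 + (top - i), top - i))).
Proof.
case: compI => c [socc hil] le; have := hil i le.
have -> // : (\sum_(0 <= l < top.+1 | i <= l) c l * 'C(2 + (l - i), l - i) =
  (i <= s) * 'C(2 + (s - i), s - i) + 'C(2 + (top - i), top - i))%N.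
transitivity (\sum_(0 <= l < top.+1 | i <= l) (l == s) * 'C(2 + (l - i), l - i) +
    \sum_(0 <= l < top.+1 | i <= l) (l == top) * 'C(2 + (l - i), l - i))%N.
  rewrite -big_split /= big_nat_cond [RHS]big_nat_cond; apply: eq_bigr => l.
  case/andP=> /andP[_ lt] _; rewrite -mulnDl.
  by rewrite (soc_dimE (socc l _)).
rewrite !sum_delta_nat le ltnS leqnn andbT /= mul1n.
by congr (_ + _)%N; congr (_ * _)%N; lia.
Qed.

Lemma homog_ideal_basis i h : has_hilb I i h ->
  exists v : 'I_('C(i + 2, i) - h) -> R,
    basis_mod (fun p => p \is i.-homog /\ p \in I) (fun p => p = 0) v.
Proof.
case=> b bb; have [B bB] := dhomog_basis k 2 i.
exact: (basis_mod_kernel (subspace_homog i) (subspace_ideal idI) bB bb).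
Qed.

Lemma bin2D n : ('C(n + 2, n) = 'C(n + 2, 2))%N.
Proof. by rewrite -(bin_sub (leq_addl n 2)) addnK. Qed.

(** In degree s-1 the minimum in the compressed Hilbert function is still the dimension of R_(s-1);
    in degree s it is the socle bound, which falls short of dim R_s by exactly s. *)
Lemma hilb_s : has_hilb I s (1 + 'C(s + 1, 2)).
Proof.
have le : (s <= top)%N by lia.
have := hilbE le; congr (has_hilb I _ _); rewrite leqnn subnn bin0.
have -> : (top - s = s - 1)%N by lia.
rewrite ![(2 + _)%N]addnC !bin2D (_ : s - 1 + 2 = s + 1)%N; last by lia.
rewrite (_ : s + 2 = (s + 1).+1)%N; last by lia.
by rewrite binS bin1; apply/minn_idPr; lia.
Qed.

Lemma hilb_pred : has_hilb I s.-1 'C(s + 1, 2).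
Proof.
have le : (s.-1 <= top)%N by lia.
have := hilbE le; congr (has_hilb I _ _).
rewrite leq_pred ![(2 + _)%N]addnC !bin2D.
rewrite (_ : s.-1 + 2 = s + 1)%N; last by lia.
rewrite (_ : top - s.-1 + 2 = (s + 1).+1)%N; last by lia.
by rewrite binS; apply/minn_idPl; lia.
Qed.

Lemma hilb_top : has_hilb I top 1.
Proof.
have := hilbE (leqnn top); congr (has_hilb I _ _).
rewrite subnn bin0 (_ : top <= s = false)%N; last by lia.
by apply/minn_idPr; rewrite mul0n add0n bin_gt0; lia.
Qed.

Lemma ideal_pred_eq0 p : p \is (s.-1).-homog -> p \in I -> p = 0.
Proof.
move=> hp Ip; have [v [_ sp _]] := homog_ideal_basis hilb_pred.
have [c] := sp p (conj hp Ip).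
have m0 : ('C(s.-1 + 2, s.-1) - 'C(s + 1, 2) = 0)%N.
  by rewrite bin2D (_ : s.-1 + 2 = s + 1)%N ?subnn //; lia.
by rewrite big1 ?subr0 // => i; have := ltn_ord i; rewrite {2}m0.
Qed.

(** A nonzero component of lower degree, multiplied by a power of x, would give a nonzero form of
    degree s-1 in I. *)
Lemma ideal_ord_ge p : p \in I -> ord_ge s p.
Proof.
move=> Ip m lt; have [//|pm] := eqVneq (p@_m) 0; exfalso.
pose q := pihomog mdeg (mdeg m) p.
have q0 : q != 0.
  by apply: contra_neq pm => /mpolyP/(_ m); rewrite mcoeff_pihomog eqxx mcoeff0.
have: 'X_i0 ^+ (s.-1 - mdeg m) * q = 0.
  apply: ideal_pred_eq0; last by apply: ideal_mull => //; apply: homI.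
  rewrite (_ : s.-1 = s.-1 - mdeg m + mdeg m)%N; last by lia.
  rewrite addnK; apply: dhomogM; [exact: dhomogXn | exact: pihomogP].
by move/eqP; rewrite mulf_eq0 expf_eq0 (negPf q0) (negPf (mpolyXU_neq0 _ _)) andbF.
Qed.

Lemma b1_notin : b1 \notin I.
Proof.
apply/negP=> Ib; have [|_ /eqP] := @soc_indep 0 1; last by rewrite oner_eq0.
by rewrite scale0r add0r scale1r.
Qed.

Lemma top_span p : p \is top.-homog -> exists c, p - c *: b1 \in I.
Proof.
move=> hp; have [b [hb sp _]] := hilb_top.
have [c] := sp _ hp; have [c'] := sp _ hb1; rewrite !big_ord1 => H' H.
have c'0 : c' ord0 != 0.
  apply/eqP=> E; case/negP: b1_notin; move: H'.
  by rewrite E scale0r subr0.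
exists (c ord0 / c' ord0).
rewrite (_ : _ - _ = p - c ord0 *: b ord0 -
    (c ord0 / c' ord0) *: (b1 - c' ord0 *: b ord0)).
  by apply: idealB => //; apply: idealZ.
by rewrite scalerBr scalerA mulfVK // opprB addrA subrK.
Qed.

(** A monomial of degree 2s is a variable times one of degree 2s-1; the latter is a multiple of [b1]
    modulo I, and [b1] is in the socle. Higher monomials are multiples of these. *)
Lemma ord_ge_ideal p : ord_ge (2 * s) p -> p \in I.
Proof.
have monI d m : mdeg m = (2 * s + d)%N -> ('X_[m] : R) \in I.
  have pred m' : (0 < mdeg m')%N -> exists i, ('X_[m'] : R) = 'X_i * 'X_[m' - U_(i)]
      /\ mdeg (m' - U_(i)) = (mdeg m').-1.
    move=> m'0; have [i mi] : exists i, m' i != 0%N.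
      apply: NNPP => no; have m'z : m' = 0%MM.
        apply/mnmP => i; rewrite mnm0E; apply/eqP/negPn/negP => mi.
        by apply: no; exists i.
      by move: m'0; rewrite m'z mdeg0.
    have le : (U_(i) <= m')%MM by rewrite lep1mP.
    exists i; rewrite -mpolyXD addmC submK //; split=> //.
    by rewrite -{2}(submK le) mdegD mdeg1 addn1.
  elim: d m => [|d IH] m Em.
    have [|i [-> Em']] := pred m; first by lia.
    have [|c Hc] := @top_span 'X_[m - U_(i)].
      by rewrite dhomogX /= Em'; apply/eqP; lia.
    rewrite -(subrK (c *: b1) 'X_[m - U_(i)]) mulrDr; apply: idealD => //.
      exact: ideal_mull.
    rewrite -scalerAr; apply: idealZ => //.
    by apply: sb1; rewrite /in_Rplus mcoeffX mnm1_eq0.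
  have [|i [-> Em']] := pred m; first by lia.
  by apply: ideal_mull => //; apply: IH; lia.
move=> Hp; rewrite (mpolyE p) big_seq.
elim/big_rec: _ => [|m q mp Iq]; first exact: ideal0.
apply: idealD => //; apply: idealZ => //.
have le : (2 * s <= mdeg m)%N.
  by rewrite leqNgt; apply/negP=> /Hp/eqP; rewrite mcoeff_eq0 mp.
by apply: (monI (mdeg m - 2 * s)%N); rewrite subnKC.
Qed.

Lemma ideal_s_basis : exists v : 'I_s -> R,
  basis_mod (fun p => p \is s.-homog /\ p \in I) (fun p => p = 0) v.
Proof.
have E : ('C(s + 2, s) - (1 + 'C(s + 1, 2)))%N = s.
  rewrite bin2D (_ : s + 2 = (s + 1).+1)%N; last by lia.
  by rewrite binS bin1; lia.
have [v bv] := homog_ideal_basis hilb_s.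
by move: v bv; rewrite E => v bv; exists v.
Qed.

End Core.

Definition to_scalar (F : fieldType) (U : lmodType F) (f : U -> F)
    (lf : scalar f) : {scalar U} :=
  HB.pack f (GRing.isLinear.Build F U F *%R f lf).

(** * Coordinates on the finite-dimensional quotient R/I *)

Section QuotientCoordinates.
Variables (k : fieldType) (I : {pred {mpoly k[3]}}) (D : nat).
Hypotheses (idI : idealr_closed I) (highI : forall p, ord_ge D p -> p \in I).
Local Notation R := {mpoly k[3]}.

Definition low_coeffs (p : R) : 'rV[k]_#|{: 'X_{1..3 < D}}| :=
  \row_i p@_(enum_val i : 'X_{1..3 < D}).

Lemma low_coeffs_is_linear : linear low_coeffs.
Proof. by move=> a p q; apply/rowP=> i; rewrite !mxE mcoeffD mcoeffZ. Qed.
HB.instance Definition _ :=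
  GRing.isLinear.Build k R _ _ low_coeffs low_coeffs_is_linear.

(** Modulo I only the coefficients below degree D matter, so R/I is the cokernel of the span [B] of
    the low coefficients of elements of I. *)
Lemma quotient_coords : exists N (pi : {linear R -> 'rV[k]_N}),
  (forall v, exists p, pi p = v) /\ (forall p, pi p = 0 <-> p \in I).
Proof.
have [r [B [_ HB sB]]] := extract_free (fun v => exists2 p, p \in I & low_coeffs p = v).
have {HB} [q Iq qB] := fin_all_exists2 HB.
have lowI p : low_coeffs p = 0 -> p \in I.
  move=> E; apply: highI => m lt.
  by have /rowP/(_ (enum_rank (BMultinom lt))) := E; rewrite !mxE enum_rankK.
have inB p : (low_coeffs p <= B)%MS <-> p \in I.
  split=> [/submxP[C HC]|Ip]; last by apply: sB; exists p.
  apply: (@ideal_subl _ _ idI _ (\sum_i C 0 i *: q i)).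
    apply: lowI; rewrite linearB /= HC linear_sum mulmx_sum_row -sumrB big1 // => i _.
    by rewrite linearZ /= qB subrr.
  exact: (subspace_comb (subspace_ideal idI)).
pose Q := cokermx B.
exists (\rank Q), (mulmxr (col_base Q) \o low_coeffs); split=> [v|p].
  have /row_fullP[C HC] := col_base_full Q.
  pose p : R := \sum_(m : 'X_{1..3 < D}) (v *m C) 0 (enum_rank m) *: 'X_[m].
  exists p => /=; suff -> : low_coeffs p = v *m C by rewrite -mulmxA HC mulmx1.
  apply/rowP=> j; rewrite mxE /p raddf_sum (bigD1 (enum_val j)) //=.
  rewrite mcoeffZ mcoeffX eqxx mulr1 enum_valK big1 ?addr0 // => m ne.
  by rewrite mcoeffZ mcoeffX -bmeqP (negPf ne) mulr0.
rewrite -inB submxE -/Q /=; split=> [E|/eqP E].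
  by rewrite -[Q]mulmx_base mulmxA E mul0mx.
apply/eqP; rewrite -(mulmx_free_eq0 _ (row_base_free Q)) -mulmxA mulmx_base.
exact/eqP.
Qed.

End QuotientCoordinates.

Section Coordinates3.
Variables (k : fieldType) (I : {pred {mpoly k[3]}}) (N : nat).
Variable pi : {linear {mpoly k[3]} -> 'rV[k]_N}.
Hypotheses (pi_surj : forall v, exists p, pi p = v).
Hypotheses (pi_ker : forall p, pi p = 0 <-> p \in I).
Local Notation R := {mpoly k[3]}.
Local Notation vec := {ffun 'I_3 -> R}.

Definition inI3 (u : vec) : Prop := forall i, u i \in I.

Definition coords3 (u : vec) : 'rV[k]_(N + (N + N)) :=
  row_mx (pi (u i0)) (row_mx (pi (u i1)) (pi (u i2))).

Lemma coords3_is_linear : linear coords3.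
Proof.
move=> a u v; rewrite /coords3 !ffunE !linearP.
by rewrite !scale_row_mx !add_row_mx.
Qed.
HB.instance Definition _ :=
  GRing.isLinear.Build k vec 'rV[k]_(N + (N + N)) _ coords3 coords3_is_linear.

Lemma coords3_surj v : exists u, coords3 u = v.
Proof.
have [a Ha] := pi_surj (lsubmx v); have [b Hb] := pi_surj (lsubmx (rsubmx v)).
have [c Hc] := pi_surj (rsubmx (rsubmx v)).
exists (vec3 a b c); rewrite /coords3 !vec3E Ha Hb Hc.
by rewrite !hsubmxK.
Qed.

Lemma coords3_ker u : coords3 u = 0 <-> inI3 u.
Proof.
split=> [E|Iu]; last by rewrite /coords3 !(pi_ker _).2 ?row_mx0.
move/eqP: E; rewrite /coords3 !row_mx_eq0 => /and3P[/eqP E0 /eqP E1 /eqP E2].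
by apply: ord3P; apply/pi_ker.
Qed.

(** The Fredholm alternative on the finite-dimensional space (R/I)^3: a functional [l] is some [b g]
    once it kills the common annihilator of these. A Koszul cycle, read as a functional, is
    recognized as a boundary in this way. *)
Lemma fredholm3 (G : lmodType k) (P : G -> Prop) (b : G -> vec -> k) (l : vec -> k) :
  subspace P -> (forall c, scalar (b^~ c)) -> (forall g, scalar (b g)) -> scalar l ->
  (forall g c, P g -> inI3 c -> b g c = 0) -> (forall c, inI3 c -> l c = 0) ->
  (forall c, (forall g, P g -> b g c = 0) -> l c = 0) ->
  exists2 g, P g & forall c, b g c = l c.
Proof.
move=> sP lb1 lb2 ll bI lI ann.
have [e He] := fin_all_exists (fun i => coords3_surj (delta_mx 0 i)).
have red c : inI3 (c - \sum_i coords3 c 0 i *: e i).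
  apply/coords3_ker; rewrite linearB linear_sum /= {1}[coords3 c]row_sum_delta.
  by rewrite -sumrB big1 // => i _; rewrite linearZ /= He subrr.
pose rb g : 'rV[k]_(N + (N + N)) := \row_i b g (e i).
have lrb : linear rb by move=> a u v; apply/rowP=> i; rewrite !mxE lb1.
have sumS (h : vec -> k) (lh : scalar h) n (z : 'I_n -> k) (u : 'I_n -> vec) :
    h (\sum_i z i *: u i) = \sum_i z i * h (u i).
  rewrite -[h]/(to_scalar lh : _ -> _) linear_sum; apply: eq_bigr => i _.
  by rewrite linearZ.
have [c Hc|g Pg Hg] := fredholm (b := to_linear lrb) (l := \row_i l (e i)) sP.
  apply/matrixP=> i j; rewrite !ord1 !mxE.
  transitivity (l (\sum_i c i 0 *: e i)).
    by rewrite sumS //; apply: eq_bigr => i' _; rewrite mxE mulrC.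
  apply: ann => g Pg; have /matrixP/(_ 0 0) := Hc g Pg; rewrite !mxE => <-.
  by rewrite sumS //; apply: eq_bigr => i' _; rewrite mxE mulrC.
exists g => // c; have ei i : b g (e i) = l (e i).
  by have /rowP/(_ i) := Hg; rewrite !mxE.
have sub (h : vec -> k) (lh : scalar h) u w : h (u - w) = h u - h w.
  by rewrite -[h]/(to_scalar lh : _ -> _) linearB.
have /eqP := bI g _ Pg (red c); rewrite sub // subr_eq0 => /eqP ->.
have /eqP := lI _ (red c); rewrite sub // subr_eq0 => /eqP ->.
by rewrite !sumS //; apply: eq_bigr => i _; rewrite ei.
Qed.

End Coordinates3.

(** * The dual functional *)

Section Duality.
Variables (k : fieldType) (s : nat) (I : {pred {mpoly k[3]}}).
Hypotheses (s3 : (3 <= s)%N) (idI : idealr_closed I) (homI : homogeneous_ideal I).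
Local Notation R := {mpoly k[3]}.
Local Notation vec := {ffun 'I_3 -> R}.
Local Notation top := (2 * s - 1)%N.
Local Notation X := (Xv k).
Implicit Types p q : R.
Implicit Types u v w : vec.

Hypothesis lowI : forall p, p \in I -> ord_ge s p.
Hypothesis highI : forall p, ord_ge (2 * s) p -> p \in I.
Hypothesis hilb_s : has_hilb I s (1 + 'C(s + 1, 2)).
Variables b0 b1 : R.
Hypotheses (hb0 : b0 \is s.-homog) (b1I : b1 \notin I) (hb1 : b1 \is top.-homog).
Hypothesis sb0 : in_socle I b0.
Hypothesis top_span : forall p, p \is top.-homog -> exists c, p - c *: b1 \in I.
Hypothesis soc_span : forall p, in_socle I p ->
  exists c0 c1, p - (c0 *: b0 + c1 *: b1) \in I.
Hypothesis soc_indep : forall c0 c1, c0 *: b0 + c1 *: b1 \in I -> c0 = 0 /\ c1 = 0.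

Variables (N : nat) (pi : {linear R -> 'rV[k]_N}).
Hypotheses (pi_surj : forall x, exists p, pi p = x).
Hypotheses (pi_ker : forall p, pi p = 0 <-> p \in I).

Lemma exists_dual_functional : exists phi : {scalar R},
  [/\ forall p, p \in I -> phi p = 0,
      forall p, phi p = phi (pihomog mdeg top p) & phi b1 = 1].
Proof.
have : pi b1 != 0 by apply: contraNneq b1I => /pi_ker.
case/rV0Pn=> j nz.
have lf : scalar (fun p => (pi b1 0 j)^-1 * pi (pihomog mdeg top p) 0 j).
  by move=> a p q; rewrite linearP linearP !mxE; ring.
exists (to_scalar lf); split=> [p Ip|p|] /=.
- have /pi_ker -> : pihomog mdeg top p \in I by apply: homI.
  by rewrite mxE mulr0.
- by rewrite pihomog_id.
- by rewrite pihomog_dE // mulVf.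
Qed.

Variable phi : {scalar R}.
Hypothesis phiI : forall p, p \in I -> phi p = 0.
Hypothesis phiP : forall p, phi p = phi (pihomog mdeg top p).
Hypothesis phib1 : phi b1 = 1.

Lemma phi_homogM d e p q : q \is e.-homog -> (d + e)%N = top ->
  phi (p * q) = phi (pihomog mdeg d p * q).
Proof. by move=> hq E; rewrite phiP -E pihomogM. Qed.

(** The component of degree s shows that [b0] cannot occur, and [phi] then reads off the coefficient
    of [b1]. This also computes the products that land in Tor_3. *)
Lemma soc_high p : ord_ge s.+1 p -> in_socle I p -> p - phi p *: b1 \in I.
Proof.
move=> Hp soc; have [c0 [c1 H]] := soc_span soc.
have c00 : c0 = 0.
  have := homI s H; rewrite linearB linearD !linearZ /=.
  rewrite (pihomog_dE hb0) (pihomog_ne0 (d := top) _ hb1); last by lia.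
  have -> : pihomog mdeg s p = 0.
    apply/mpolyP=> m; rewrite mcoeff_pihomog mcoeff0; case: eqP => // E.
    by apply: Hp; rewrite E.
  rewrite scaler0 addr0 sub0r => /(idealN idI); rewrite opprK => H'.
  by have [|] := @soc_indep c0 0; first by rewrite scale0r addr0.
suff <- : c1 = phi p by rewrite -[c1 *: b1]add0r -(scale0r b0) -c00.
have /eqP := phiI H; rewrite linearB linearD !linearZ /= c00 phib1 mul0r add0r mulr1.
by rewrite subr_eq0 => /eqP.
Qed.

(** Descending induction on the order, starting at 2s: the products ['X_i * p] have higher order and
    the same property, so they lie in I. Thus [p] is in the socle, and by [soc_high] it is
    [phi p = 0] times [b1] modulo I. *)
Lemma ideal_of_phi p : ord_ge s.+1 p -> (forall c, phi (p * c) = 0) -> p \in I.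
Proof.
suff step n : forall p, ord_ge s.+1 p -> ord_ge (2 * s - n) p ->
    (forall c, phi (p * c) = 0) -> p \in I.
  by move=> Hp; apply: (step (2 * s)%N) => //; rewrite subnn.
elim: n => [|n IH] {}p Hp' Hp phip; first by apply: highI; rewrite subn0 in Hp.
suff soc : in_socle I p.
  have := soc_high Hp' soc; have := phip 1; rewrite mulr1 => ->.
  by rewrite scale0r subr0.
have hX i : ord_ge 1 ('X_i : R) := homog_ord_ge (leqnn 1) (dhomogXU k i).
apply/in_socleXP => // i; apply: IH.
- by apply: ord_geW (ord_geM (hX i) Hp'); lia.
- by apply: ord_geW (ord_geM (hX i) Hp); lia.
- by move=> c; rewrite -mulrA mulrCA; apply: phip.
Qed.

(** The products ['X_i * p] have degree s+1, where [phi] detects everything outside I. Hence [p] is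
    in the socle, whose part of degree s is the line of [b0]. *)
Lemma phi_radical_s p : p \is s.-homog ->
  (forall c, c \is (s.-1).-homog -> phi (p * c) = 0) -> exists a, p - a *: b0 \in I.
Proof.
move=> hp phip.
have [|c0 [c1 H]] := @soc_span p.
  apply/in_socleXP => // i; apply: ideal_of_phi => [|c].
    exact: (homog_ord_ge (leqnn s.+1) (dhomogM (dhomogXU k i) hp)).
  rewrite -mulrA mulrCA mulrC (@phi_homogM s.-1 s) //; last by lia.
  by rewrite mulrC phip // pihomogP.
have := homI s H; rewrite linearB linearD !linearZ /=.
rewrite (pihomog_dE hp) (pihomog_dE hb0) (pihomog_ne0 (d := top) _ hb1); last by lia.
by rewrite scaler0 addr0; exists c0.
Qed.

(* The pairing of R_(s-1) with (R/I)_s has a right kernel of dimension at most 1,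
   the socle, while dim (R/I)_s = 1 + dim R_(s-1): so its left kernel vanishes. *)
Lemma phi_nondeg_pred c : c \is (s.-1).-homog ->
  (forall p, p \is s.-homog -> phi (c * p) = 0) -> c = 0.
Proof.
move=> hc phic.
have [B [hB spB iB]] := dhomog_basis k 2 s.-1.
have [b [hb spb ib]] := hilb_s.
have E1 : 'C(s.-1 + 2, s.-1) = 'C(s + 1, 2).
  by rewrite bin2D (_ : s.-1 + 2 = s + 1)%N //; lia.
pose G := \matrix_(j, i) phi (B i * b j).
have sumE n (z : 'rV[k]_n) (f : 'I_n -> R) q :
    phi (q * \sum_j z 0 j *: f j) = \sum_j z 0 j * phi (q * f j).
  rewrite mulr_sumr linear_sum; apply: eq_bigr => j _.
  by rewrite -scalerAr linearZ.
have rK : (\rank (kermx G) <= 1)%N.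
  have [K [KG fK]] : exists K : 'M_(\rank (kermx G), _), K *m G = 0 /\ row_free K.
    exists (row_base (kermx G)); rewrite row_base_free; split=> //.
    by apply/sub_kermxP; rewrite eq_row_base.
  pose V p := p \is s.-homog /\ forall c, c \is (s.-1).-homog -> phi (p * c) = 0.
  have bV : basis_mod V (fun p => p \in I) (fun _ : 'I_1 => b0).
    split=> [_|p [hp /(phi_radical_s hp)[a Ha]]|z].
    - split=> // c' hc'; apply: phiI; rewrite mulrC; apply: sb0.
      by apply: (dhomog_nemf_coeff hc'); rewrite /= mdeg0; lia.
    - by exists (fun=> a); rewrite big_ord1.
    - rewrite big_ord1 -[_ *: _]addr0 -(scale0r b1) => /soc_indep[z0 _] i.
      by rewrite ord1.
  apply: (indep_mod_leq (subspace_ideal idI) bV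
            (c := fun i => \sum_j K i j *: b j)) => [i|z Iz i].
    split=> [|c' hc']; first exact: (subspace_comb (subspace_homog _ _)).
    have [y] := spB c' hc'; move/eqP; rewrite subr_eq0 => /eqP ->.
    rewrite mulrC mulr_suml linear_sum big1 // => l _.
    rewrite -scalerAl linearZ /=.
    have -> : \sum_j K i j *: b j = \sum_j row i K 0 j *: b j.
      by apply: eq_bigr => j _; rewrite mxE.
    rewrite sumE; have /matrixP/(_ i l) := KG; rewrite !mxE => E.
    apply/eqP; rewrite mulf_eq0; apply/orP; right; apply/eqP.
    by rewrite -[RHS]E; apply: eq_bigr => j _; rewrite !mxE.
  have : (\row_i z i) *m K = 0.
    apply/rowP=> l; rewrite [RHS]mxE; apply: (ib (fun l => ((\row_i z i) *m K) 0 l)).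
    suff <- : \sum_j z j *: (\sum_l K j l *: b l) =
        \sum_l ((\row_i z i) *m K) 0 l *: b l by [].
    under eq_bigr do rewrite scaler_sumr.
    rewrite exchange_big; apply: eq_bigr => l' _; rewrite [in RHS]mxE scaler_suml.
    by apply: eq_bigr => j _; rewrite scalerA [in RHS]mxE.
  move/eqP; rewrite (mulmx_free_eq0 _ fK) => /eqP/rowP/(_ i).
  by rewrite !mxE.
have fG : row_free G^T.
  move: rK; rewrite mxrank_ker => rK.
  by rewrite /row_free eqn_leq rank_leq_row mxrank_tr {1}E1; lia.
have [z] := spB c hc; move/eqP; rewrite subr_eq0 => /eqP def_c.
have : (\row_i z i) *m G^T == 0.
  apply/eqP/rowP=> j; rewrite [RHS]mxE -[RHS](phic _ (hb j)) def_c.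
  rewrite mulr_suml linear_sum mxE; apply: eq_bigr => i _.
  by rewrite !mxE -scalerAl linearZ.
rewrite mulmx_free_eq0 // => /eqP/rowP z0.
by rewrite def_c big1 // => i _; have := z0 i; rewrite !mxE => ->; rewrite scale0r.
Qed.

(** A component of degree d < s is multiplied by x^(s-1-d), which reduces the claim to degree
    s-1. *)
Lemma phi_nondeg c : (forall p, ord_ge s p -> phi (c * p) = 0) -> ord_ge s c.
Proof.
move=> phic m lt; set d := mdeg m in lt.
suff : pihomog mdeg d c = 0.
  by move/mpolyP/(_ m); rewrite mcoeff_pihomog eqxx mcoeff0.
pose Y := 'X_i0 ^+ (s.-1 - d) : R.
have hY : Y \is (s.-1 - d).-homog := dhomogXn k i0 _.
have : Y * pihomog mdeg d c = 0.
  apply: phi_nondeg_pred => [|q hq].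
    rewrite [X in X.-homog](_ : s.-1 = s.-1 - d + d)%N; last by lia.
    by apply: dhomogM => //; apply: pihomogP.
  have hYq : (Y * q) \is (s.-1 - d + s).-homog by apply: dhomogM.
  rewrite mulrAC mulrC -(phi_homogM _ hYq); last by lia.
  by apply: phic; apply: homog_ord_ge hYq; lia.
by move/eqP; rewrite mulf_eq0 expf_eq0 (negPf (mpolyXU_neq0 _ _)) andbF => /eqP.
Qed.

End Duality.

(** * Koszul cycles and Macaulay duality *)

Section GradedVectors.
Variable F : fieldType.
Local Notation R := {mpoly F[3]}.
Local Notation vec := {ffun 'I_3 -> R}.
Local Notation X := (Xv F).
Implicit Types (u v w : vec) (p q : R).

Definition ge3 n u : Prop := forall i, ord_ge n (u i).
Definition hom3 n u : Prop := forall i, u i \is n.-homog.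
Definition trunc3 n u : vec := [ffun i => trunc n (u i)].
Definition pihomog3 n u : vec := [ffun i => pihomog mdeg n (u i)].
Definition delta3 i p : vec := [ffun j => if j == i then p else 0].

Lemma subspace_ge3 n : subspace (ge3 n).
Proof.
split=> [i|a u v Hu Hv i]; rewrite !ffunE; first exact: (subspace_ord_ge F n).1.
exact: (subspace_ord_ge F n).2.
Qed.

Lemma ge3_subtrunc n u : ge3 n (u - trunc3 n u).
Proof. by move=> i; rewrite !ffunE; apply: ord_ge_subtrunc. Qed.

Lemma trunc3_ge3 n u : ge3 n u -> trunc3 n u = 0.
Proof. by move=> Hu; apply/ffunP=> i; rewrite !ffunE; apply: trunc_ord_ge. Qed.

Lemma hom3_ge3 n u : hom3 n u -> ge3 n u.
Proof. by move=> Hu i; apply: homog_ord_ge (leqnn n) (Hu i). Qed.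

Lemma ge3W m n u : (m <= n)%N -> ge3 n u -> ge3 m u.
Proof. by move=> le Hu i; apply: ord_geW le (Hu i). Qed.

Lemma hom3_pihomog3 n u : hom3 n (pihomog3 n u).
Proof. by move=> i; rewrite ffunE; apply: pihomogP. Qed.

Lemma hom3_Xv : hom3 1 X.
Proof. by move=> i; rewrite XvE; apply: dhomogXU. Qed.

Lemma dot_ge3 m n u v : ge3 m u -> ge3 n v -> ord_ge (m + n) (dot u v).
Proof.
move=> Hu Hv; have sP := subspace_ord_ge F (m + n).
by apply: (subspaceD sP); [apply: (subspaceD sP)|]; apply: ord_geM.
Qed.

Lemma cross_ge3 m n u v : ge3 m u -> ge3 n v -> ge3 (m + n) (cross u v).
Proof.
move=> Hu Hv; have sP := subspace_ord_ge F (m + n).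
by apply: ord3P; rewrite /cross vec3E; apply: (subspaceB sP); apply: ord_geM.
Qed.

Lemma dot_hom3 m n u v : hom3 m u -> hom3 n v -> dot u v \is (m + n).-homog.
Proof. by move=> Hu Hv; rewrite /dot !dhomogD ?dhomogM. Qed.

Lemma cross_hom3 m n u v : hom3 m u -> hom3 n v -> hom3 (m + n) (cross u v).
Proof.
by move=> Hu Hv; apply: ord3P; rewrite /cross vec3E;
  apply: (subspaceB (subspace_homog F (m + n)));
  apply: dhomogM.
Qed.

Lemma dot_Xv_trunc3 n u : dot X (trunc3 n u) = trunc n.+1 (dot X u).
Proof. by rewrite /dot !linearD /= !ffunE !truncXM. Qed.

Lemma cross_Xv_trunc3 n u : cross X (trunc3 n u) = trunc3 n.+1 (cross X u).
Proof.
by apply: eq_vec3; rewrite /cross !ffunE /= linearB /= !truncXM.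
Qed.

Lemma dot_Xv_pihomog3 n u : dot X (pihomog3 n u) = pihomog mdeg n.+1 (dot X u).
Proof. by rewrite /dot !linearD /= !ffunE !pihomogXM. Qed.

Lemma cross_Xv_pihomog3 n u : cross X (pihomog3 n u) = pihomog3 n.+1 (cross X u).
Proof.
by apply: eq_vec3; rewrite /cross !ffunE /= linearB /= !pihomogXM.
Qed.

Lemma dot_delta3 u i p : dot u (delta3 i p) = u i * p.
Proof. by elim/ord3P: i; rewrite /dot !ffunE /=; ring. Qed.

Lemma ge3_delta3 n i p : ord_ge n p -> ge3 n (delta3 i p).
Proof. by move=> Hp j; rewrite ffunE; case: eqP => // _ m; rewrite mcoeff0. Qed.

Lemma linear_dot u : linear (dot u).
Proof. by move=> a v w; rewrite /dot !ffunE -!mul_mpolyC; ring. Qed.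

Lemma linear_cross u : linear (cross u).
Proof. by move=> a v w; apply: eq_vec3; rewrite /cross !ffunE /= -!mul_mpolyC; ring. Qed.

Lemma dot0 u : dot u 0 = 0.
Proof. by rewrite /dot !ffunE; ring. Qed.

Lemma cross0 u : cross u 0 = 0.
Proof. by apply: eq_vec3; rewrite /cross !ffunE /=; ring. Qed.

Lemma dot_comb u n (z : 'I_n -> F) (w : 'I_n -> vec) :
  dot u (\sum_j z j *: w j) = \sum_j z j *: dot u (w j).
Proof.
rewrite -[dot u _]/(to_linear (linear_dot u) _) linear_sum.
by apply: eq_bigr => j _; rewrite linearZ.
Qed.

Lemma cross_comb u n (z : 'I_n -> F) (w : 'I_n -> vec) :
  cross u (\sum_j z j *: w j) = \sum_j z j *: cross u (w j).
Proof.
rewrite -[cross u _]/(to_linear (linear_cross u) _) linear_sum.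
by apply: eq_bigr => j _; rewrite linearZ.
Qed.

Lemma trunc3_is_linear n : linear (trunc3 n).
Proof. by move=> a v w; apply/ffunP=> i; rewrite !ffunE linearP. Qed.

End GradedVectors.

Section TorCycles.
Variables (k : fieldType) (I : {pred {mpoly k[3]}}).
Local Notation R := {mpoly k[3]}.
Local Notation vec := {ffun 'I_3 -> R}.
Local Notation X := (Xv k).
Implicit Types (u v w : vec) (p q : R).

(** In the coordinates [K1], [K2], [K3] below, and up to sign, the differentials of the Koszul
    complex are p -> p X, w -> X x w and u -> X . u. These are the cycles and boundaries of K/IK in
    homological degrees 1 and 2. *)
Definition cyc1 u : Prop := dot X u \in I.
Definition bnd1 u : Prop := exists w, inI3 I (u - cross X w).
Definition cyc2 w : Prop := inI3 I (cross X w).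
Definition bnd2 w : Prop := exists p, inI3 I (w - scale3 p X).

Hypothesis idI : idealr_closed I.

Lemma subspace_inI3 : subspace (inI3 I).
Proof.
split=> [i|a u v Iu Iv i]; rewrite !ffunE; first exact: ideal0.
exact: (subspace_ideal idI).2.
Qed.

Lemma cross_inI3 u v : inI3 I v -> inI3 I (cross u v).
Proof.
by move=> Iv; apply: ord3P; rewrite /cross vec3E; apply: idealB => //; apply: ideal_mull.
Qed.

Lemma subspace_cyc1 : subspace cyc1.
Proof.
split=> [|a u v Cu Cv]; rewrite /cyc1.
  by rewrite dot0 ideal0.
by rewrite linear_dot; exact: ((subspace_ideal idI).2 a _ _ Cu Cv).
Qed.

Lemma subspace_cyc2 : subspace cyc2.
Proof.
split=> [|a u v Cu Cv]; rewrite /cyc2.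
  by rewrite cross0; apply: subspace0 subspace_inI3.
by rewrite linear_cross; exact: (subspace_inI3.2 a _ _ Cu Cv).
Qed.

Lemma subspace_bnd1 : subspace bnd1.
Proof.
split=> [|a u v [w Hw] [w' Hw']].
  exists 0; rewrite cross0 subr0.
  exact: subspace0 subspace_inI3.
exists (a *: w + w'); rewrite linear_cross.
rewrite (_ : _ - _ = a *: (u - cross X w) + (v - cross X w')).
  exact: (subspace_inI3.2 a _ _ Hw Hw').
by rewrite scalerBr opprD addrACA.
Qed.

Lemma scale3_is_linear u a p q : scale3 (a *: p + q) u = a *: scale3 p u + scale3 q u.
Proof. by apply/ffunP=> i; rewrite !ffunE mulrDl scalerAl. Qed.

Lemma subspace_bnd2 : subspace bnd2.
Proof.
split=> [|a u v [w Hw] [w' Hw']].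
  exists 0; rewrite (_ : scale3 0 X = 0); last by apply/ffunP=> i; rewrite !ffunE mul0r.
  by rewrite subr0; exact: subspace0 subspace_inI3.
exists (a *: w + w'); rewrite scale3_is_linear.
rewrite (_ : _ - _ = a *: (u - scale3 w X) + (v - scale3 w' X)).
  exact: (subspace_inI3.2 a _ _ Hw Hw').
by rewrite scalerBr opprD addrACA.
Qed.

Lemma bnd1_cyc1 u : bnd1 u -> cyc1 u.
Proof.
case=> w Hw; rewrite /cyc1 -(subrK (cross X w) u) dotDr dot_crossr addr0.
exact: ideal_dot.
Qed.

Lemma bnd2_cyc2 w : bnd2 w -> cyc2 w.
Proof.
case=> p Hp; rewrite /cyc2 -(subrK (scale3 p X) w) crossDr cross_scale addr0.
exact: cross_inI3.
Qed.

Lemma dot_bnd1_cyc2 u w : bnd1 u -> cyc2 w -> dot u w \in I.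
Proof.
case=> v Hv Cw; rewrite -(subrK (cross X v) u) dotC dotDr [dot _ (cross _ _)]dotC.
rewrite dot_cross_swap; apply: idealD => //; first exact: ideal_dot.
by apply: idealN => //; apply: ideal_dot.
Qed.

Lemma dot_cyc1_bnd2 u w : cyc1 u -> bnd2 w -> dot u w \in I.
Proof.
move=> Cu [p Hp]; rewrite -(subrK (scale3 p X) w) dotDr dot_scaler [dot u X]dotC.
by apply: idealD => //; [apply: ideal_dot | apply: ideal_mull].
Qed.

Lemma cross_cyc1 u v : cyc1 u -> cyc1 v -> cyc2 (cross u v).
Proof.
move=> Cu Cv; rewrite /cyc2.
have -> : cross X (cross u v) = scale3 (dot X v) u - scale3 (dot X u) v.
  by apply: eq_vec3; rewrite /cross /dot !ffunE /=; ring.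
by move=> i; rewrite !ffunE; apply: idealB => //;
  [apply: (ideal_mulr idI _ Cv) | apply: (ideal_mulr idI _ Cu)].
Qed.

Lemma dot_cyc_socle u w : cyc1 u -> cyc2 w -> in_socle I (dot u w).
Proof.
move=> Cu Cw; apply/in_socleXP => // i.
have -> : 'X_i * dot u w = w i * dot X u + cross u (cross X w) i.
  by elim/ord3P: i; rewrite /cross /dot !ffunE /=; ring.
by apply: idealD => //; [apply: ideal_mull | apply: cross_inI3].
Qed.

End TorCycles.

Section TorDuality.
Variables (k : fieldType) (s : nat) (I : {pred {mpoly k[3]}}).
Hypotheses (s3 : (3 <= s)%N) (idI : idealr_closed I) (homI : homogeneous_ideal I).
Local Notation R := {mpoly k[3]}.
Local Notation vec := {ffun 'I_3 -> R}.
Local Notation X := (Xv k).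
Implicit Types p q : R.
Implicit Types u v w : vec.

Hypothesis lowI : forall p, p \in I -> ord_ge s p.
Hypothesis highI : forall p, ord_ge (2 * s) p -> p \in I.
Variables (N : nat) (pi : {linear R -> 'rV[k]_N}).
Hypotheses (pi_surj : forall x, exists p, pi p = x).
Hypotheses (pi_ker : forall p, pi p = 0 <-> p \in I).
Variable phi : {scalar R}.
Hypothesis phiI : forall p, p \in I -> phi p = 0.
Hypothesis ideal_of_phi : forall p,
  ord_ge s.+1 p -> (forall c, phi (p * c) = 0) -> p \in I.
Hypothesis phi_nondeg : forall c,
  (forall p, ord_ge s p -> phi (c * p) = 0) -> ord_ge s c.

Lemma phi_dot_linear u : scalar (fun v => phi (dot u v)).
Proof. by move=> a v w; rewrite linear_dot linearP. Qed.

Lemma phi_dotB u v w : phi (dot u (v - w)) = phi (dot u v) - phi (dot u w).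
Proof. by rewrite dotBr linearB. Qed.

Lemma trunc3_dot c : ord_ge s (dot X c) -> dot X (trunc3 s.-1 c) = 0.
Proof. by move=> H; rewrite dot_Xv_trunc3 prednK ?trunc_ord_ge //; lia. Qed.

Lemma trunc3_cross c : ge3 s (cross X c) -> cross X (trunc3 s.-1 c) = 0.
Proof. by move=> H; rewrite cross_Xv_trunc3 prednK ?trunc3_ge3 //; lia. Qed.

(** [trunc3 s.-1] keeps degrees up to s-2. What it drops has degree at least s-1 and pairs with [w]
    into order at least 2s, that is, into I. *)
Lemma phi_dot_trunc3 w c : ge3 s.+1 w ->
  phi (dot w c) = phi (dot w (trunc3 s.-1 c)).
Proof.
move=> Hw; apply/eqP; rewrite -subr_eq0 -phi_dotB; apply/eqP/phiI/highI.
by apply: ord_geW (dot_ge3 Hw (@ge3_subtrunc k s.-1 c)); lia.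
Qed.

Lemma inI3_of_phi w : ge3 s.+1 w -> (forall c, phi (dot w c) = 0) -> inI3 I w.
Proof.
move=> Hw H i; apply: ideal_of_phi => // c.
by rewrite -dot_delta3.
Qed.

Lemma inI3_low u : inI3 I u -> ge3 s u.
Proof. by move=> Iu i; apply: lowI. Qed.

(* Macaulay duality: in degrees >= s+1 the module R/I is dual to the polynomials
   of degree <= s-2, whose Koszul complex is exact. *)
Lemma cyc2_high w : cyc2 I w -> ge3 s.+1 w -> bnd2 I w.
Proof.
move=> Cw Hw.
have [||||||c Hc|p Hp Ep] := @fredholm3 _ I _ pi pi_surj pi_ker R (ord_ge s)
    (fun p c => phi (p * dot X c)) (fun c => phi (dot w c)).
- exact: subspace_ord_ge.
- by move=> c a p q; rewrite mulrDl -scalerAl linearP.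
- by move=> p a u v; rewrite linear_dot mulrDr -scalerAr linearP.
- exact: phi_dot_linear.
- by move=> p c _ Ic; apply/phiI/ideal_mull => //; apply: ideal_dot.
- by move=> c Ic; apply/phiI/ideal_dot.
(* If all [p] of order at least s kill [c], then X . c has order at least s, so the part of [c] of
   degree at most s-2 is an honest syzygy of X, say X x e. It pairs to zero with [w] because X x w
   has entries in I. *)
- rewrite phi_dot_trunc3 //.
  have /trunc3_dot/dot_Xv_eq0[e ->] : ord_ge s (dot X c).
    by apply: phi_nondeg => p /Hc; rewrite mulrC.
  rewrite dotC dot_cross_swap linearN /= phiI ?oppr0 //.
  exact: ideal_dot.
exists p; apply: inI3_of_phi => [|c].
  apply: (subspaceB (subspace_ge3 _ _)) => // i; rewrite ffunE.
  have hX : ord_ge 1 (X i) := homog_ord_ge (leqnn 1) (hom3_Xv k i).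
  by apply: ord_geW (ord_geM Hp hX); rewrite addn1.
rewrite dotC phi_dotB [dot c w]dotC dot_scaler [dot c X]dotC Ep subrr //.
Qed.

(** The same duality one spot further along the complex. A [c] killed by all X x w has a low part X
    x c = 0, which is a multiple of X, and [u] kills it because X . u lies in I. *)
Lemma cyc1_high u : cyc1 I u -> ge3 s.+1 u -> bnd1 I u.
Proof.
move=> Cu Hu.
have [||||||c Hc|w Hw Ew] := @fredholm3 _ I _ pi pi_surj pi_ker vec (ge3 s)
    (fun w c => phi (dot (cross X w) c)) (fun c => phi (dot u c)).
- exact: subspace_ge3.
- move=> c a v w; rewrite linear_cross ![dot _ c]dotC; exact: phi_dot_linear.
- move=> w a u' v; exact: phi_dot_linear.
- exact: phi_dot_linear.
- by move=> p c _ Ic; apply/phiI/ideal_dot.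
- by move=> c Ic; apply/phiI/ideal_dot.
- rewrite phi_dot_trunc3 //.
  have /trunc3_cross/cross_Xv_eq0[p ->] : ge3 s (cross X c).
    move=> i; apply: phi_nondeg => p Hp; rewrite -dot_delta3 dotC.
    have /eqP := Hc _ (ge3_delta3 i Hp).
    by rewrite dot_cross_swap linearN oppr_eq0 => /eqP.
  by rewrite dot_scaler phiI // [dot u X]dotC; apply: ideal_mull.
exists w; apply: inI3_of_phi => [|c].
  apply: (subspaceB (subspace_ge3 _ _)) => //.
  exact: cross_ge3 (hom3_ge3 (hom3_Xv k)) Hw.
by rewrite dotC phi_dotB ![dot c _]dotC Ew subrr.
Qed.

(** Below degree s the ideal is zero, so the low part of a cycle modulo I is a cycle over R, where
    the complex is exact. *)
Lemma cyc1_low u : cyc1 I u -> bnd1 I (trunc3 s.-1 u).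
Proof.
move=> /lowI/trunc3_dot/dot_Xv_eq0[w ->]; exists w; rewrite subrr.
exact: subspace0 (subspace_inI3 idI).
Qed.

Lemma cyc2_low w : cyc2 I w -> bnd2 I (trunc3 s.-1 w).
Proof.
move=> /inI3_low/trunc3_cross/cross_Xv_eq0[p ->]; exists p; rewrite subrr.
exact: subspace0 (subspace_inI3 idI).
Qed.

(** These are degrees of coefficients. The internal degrees are s and s+1 in Tor_1, s+1 and s+2 in
    Tor_2. *)
Definition middle u : Prop := hom3 s.-1 u \/ hom3 s u.

Lemma middle_decomp (C B : vec -> Prop) u :
  subspace C -> subspace B -> (forall v, B v -> C v) ->
  (forall v, C v -> B (trunc3 s.-1 v)) -> (forall v, C v -> ge3 s.+1 v -> B v) ->
  (forall n v, C v -> C (pihomog3 n v)) -> C u ->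
  exists h h', [/\ C h /\ middle h, C h' /\ middle h' & B (u - (h + h'))].
Proof.
move=> sC sB BC lowB highB Chom Cu.
exists (pihomog3 s.-1 u), (pihomog3 s u); split.
- by split; [apply: Chom | left; apply: hom3_pihomog3].
- by split; [apply: Chom | right; apply: hom3_pihomog3].
pose r := u - trunc3 s.-1 u - (pihomog3 s.-1 u + pihomog3 s u).
have -> : u - (pihomog3 s.-1 u + pihomog3 s u) = trunc3 s.-1 u + r.
  by rewrite /r addrA addrCA subrr addr0.
have Bl := lowB u Cu; apply: (subspaceD sB) => //.
apply: highB.
  apply: (subspaceB sC); last by apply: (subspaceD sC); apply: Chom.
  by apply: (subspaceB sC) => //; apply: BC.
move=> i; rewrite (_ : r i = u i - trunc s.+1 (u i)); first exact: ord_ge_subtrunc.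
have s1 : s = s.-1.+1 by rewrite prednK //; lia.
rewrite trunc_split {1}s1 trunc_split !ffunE; ring.
Qed.

Lemma cyc1_decomp u : cyc1 I u ->
  exists h h', [/\ cyc1 I h /\ middle h, cyc1 I h' /\ middle h' & bnd1 I (u - (h + h'))].
Proof.
apply: middle_decomp.
- exact: subspace_cyc1.
- exact: subspace_bnd1.
- exact: bnd1_cyc1.
- exact: cyc1_low.
- exact: cyc1_high.
- by move=> n v Cv; rewrite /cyc1 dot_Xv_pihomog3; apply: homI.
Qed.

Lemma cyc2_decomp u : cyc2 I u ->
  exists h h', [/\ cyc2 I h /\ middle h, cyc2 I h' /\ middle h' & bnd2 I (u - (h + h'))].
Proof.
apply: middle_decomp.
- exact: subspace_cyc2.
- exact: subspace_bnd2.
- exact: bnd2_cyc2.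
- exact: cyc2_low.
- exact: cyc2_high.
- by move=> n v Cv i; rewrite cross_Xv_pihomog3 ffunE; apply: homI.
Qed.

(** [hi] keeps the degrees >= s. A [c] whose high part is killed by every X x w has X x (hi c) in I
    by [ideal_of_phi], so [hi c] is a cycle and [u] kills it. Hence, on vectors of order at least s,
    [u] acts like some X x e, and [phi_nondeg] gives X x e - u order at least s. Dotting with X
    shows that X . u, homogeneous of degree s, has order above s. *)
Lemma pairing_left_nondeg u : hom3 s.-1 u ->
  (forall w, ge3 s w -> cyc2 I w -> phi (dot u w) = 0) -> dot X u = 0.
Proof.
move=> hu Hu; pose hi c : vec := c - trunc3 s c.
have lhi : linear hi.
  by move=> a v w; rewrite /hi trunc3_is_linear scalerBr opprD addrACA.
have hiI c : inI3 I c -> inI3 I (hi c).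
  move=> Ic; apply: (subspaceB (subspace_inI3 idI)) => // i.
  by rewrite ffunE; apply: ideal_trunc.
have [||||||c Hc|e _ Ee] := @fredholm3 _ I _ pi pi_surj pi_ker vec (fun=> True)
    (fun w c => phi (dot (cross X w) (hi c))) (fun c => phi (dot u (hi c))).
- by [].
- move=> c a v w; rewrite linear_cross ![dot _ (hi c)]dotC; exact: phi_dot_linear.
- move=> w a u' v; rewrite lhi; exact: phi_dot_linear.
- move=> a u' v; rewrite lhi; exact: phi_dot_linear.
- by move=> p c _ Ic; apply/phiI/ideal_dot => //; apply: hiI.
- by move=> c Ic; apply/phiI/ideal_dot => //; apply: hiI.
- apply: Hu; first exact: ge3_subtrunc.
  apply: inI3_of_phi => [|c'].
    exact: cross_ge3 (hom3_ge3 (hom3_Xv k)) (@ge3_subtrunc k s c).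
  have /eqP := Hc c' Logic.I; rewrite dot_cross_swap linearN oppr_eq0 => /eqP.
  by rewrite dotC.
have small : ge3 s (cross X e - u).
  move=> i; apply: phi_nondeg => p Hp; rewrite -dot_delta3 dotC phi_dotB.
  have hip : hi (delta3 i p) = delta3 i p.
    by rewrite /hi trunc3_ge3 ?subr0 //; apply: ge3_delta3.
  have := Ee (delta3 i p); rewrite hip => E.
  by rewrite ![dot (delta3 _ _) _]dotC E subrr.
have hX := hom3_ge3 (hom3_Xv k).
have := dot_ge3 hX small; rewrite dotBr dot_crossr sub0r => Hs.
apply: (@ord_ge_eq0 _ s.+1).
  by move=> m lt; have := Hs m lt; rewrite mcoeffN => /eqP; rewrite oppr_eq0 => /eqP.
have hXu := dot_hom3 (hom3_Xv k) hu.
rewrite msizeE; apply/bigmax_leqP_seq => m mX _.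
by rewrite (dhomog_mf hXu mX); lia.
Qed.

(** The product has order at least 2(s-1), and 2(s-1) >= s+1 is the condition s >= 3. There all
    2-cycles are boundaries. *)
Lemma cross_cyc1_bnd u v : cyc1 I u -> cyc1 I v -> ge3 s.-1 u -> ge3 s.-1 v ->
  bnd2 I (cross u v).
Proof.
move=> Cu Cv Hu Hv; apply: cyc2_high; first exact: cross_cyc1.
by apply: ge3W (cross_ge3 Hu Hv); lia.
Qed.

Lemma middle_ge3 u : middle u -> ge3 s.-1 u.
Proof. by case=> /hom3_ge3 //; apply: ge3W; rewrite leq_pred. Qed.

End TorDuality.

(** * Linear syzygies at a generic point *)

(** Independence over [k] is freeness of the rows of a matrix with entries in [k], and the rank does
    not change under a field extension. *)
Lemma free_extension (k K : fieldType) (iota : {rmorphism k -> K}) (J T : finType)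
    (f : J -> T -> k) :
  (forall z : J -> k, (forall t, \sum_j z j * f j t = 0) -> forall j, z j = 0) ->
  forall u : J -> K, (forall t, \sum_j u j * iota (f j t) = 0) -> forall j, u j = 0.
Proof.
move=> indf u Hu; pose A := \matrix_(i < #|J|, l < #|T|) f (enum_val i) (enum_val l).
have sumE (V : fieldType) (y : J -> V) (g : J -> V) :
    \sum_(i < #|J|) y (enum_val i) * g (enum_val i) = \sum_j y j * g j.
  by rewrite [RHS](reindex _ (onW_bij _ (@enum_val_bij J))).
have fA : row_free A.
  rewrite -kermx_eq0; apply/eqP/row_matrixP=> i; rewrite row0.
  have := row_sub i (kermx A); move: (row i _) => y /sub_kermxP yA.
  apply/rowP=> l; rewrite mxE -(enum_valK l).
  apply: (indf (fun j => y 0 (enum_rank j))) => t.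
  rewrite -(sumE k); move/rowP/(_ (enum_rank t)): yA; rewrite !mxE => E.
  by rewrite -[RHS]E; apply: eq_bigr => i' _; rewrite mxE !enum_rankK enum_valK.
have : (\row_i u (enum_val i)) *m map_mx iota A == 0.
  apply/eqP/rowP=> l; rewrite !mxE -[RHS](Hu (enum_val l)) -(sumE K).
  by apply: eq_bigr => i _; rewrite !mxE.
rewrite mulmx_free_eq0 ?row_free_map // => /eqP/rowP H j.
by have := H (enum_rank j); rewrite !mxE enum_rankK.
Qed.

Section LineDivision.
Variables (K : fieldType) (a b : K).
Local Notation S := {mpoly K[3]}.

Definition line_subst (f : S) : S := f \mPo [tuple ('X_i0 : S); 'X_i1; b *: 'X_i0].

Lemma line_subst_is_linear : linear line_subst.
Proof. by move=> c f g; rewrite /line_subst linearP. Qed.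
HB.instance Definition _ := GRing.isLinear.Build K S S _ line_subst line_subst_is_linear.

Lemma line_substM f g : line_subst (f * g) = line_subst f * line_subst g.
Proof. by rewrite /line_subst rmorphM. Qed.

Lemma line_substX i : line_subst 'X_i = if i == i2 then b *: 'X_i0 else 'X_i.
Proof. by elim/ord3P: i; rewrite /line_subst comp_mpolyXU. Qed.

Lemma sub_subst_dvd (f : S) : exists h, f - line_subst f = ('X_i2 - b *: 'X_i0) * h.
Proof.
pose D f := exists h, f - line_subst f = ('X_i2 - b *: 'X_i0) * h.
have DM : forall f1 f2, D f1 -> D f2 -> D (f1 * f2).
  move=> f1 f2 [h1 E1] [h2 E2]; exists (h1 * f2 + line_subst f1 * h2).
  by rewrite line_substM mulrDr mulrA -E1 mulrCA -E2; ring.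
have D1 : D 1 by exists 0; rewrite /line_subst rmorph1 subrr mulr0.
have DX i : D 'X_i.
  elim/ord3P: i; rewrite /D line_substX /=; [exists 0|exists 0|exists 1].
  - by rewrite subrr mulr0.
  - by rewrite subrr mulr0.
  - by rewrite mulr1.
have Dexp : forall f n, D f -> D (f ^+ n).
  by move=> g n Dg; elim: n => [|n IH];
    [rewrite expr0; exact: D1 | rewrite exprS; exact: (DM _ _ Dg IH)].
elim/mpolyind: f => [|c m f _ _ [h E]].
  by exists 0; rewrite linear0 subrr mulr0.
have [h' E'] : D 'X_[m].
  by rewrite mpolyXE_id; apply: (big_ind D D1 DM) => i _; exact: (Dexp _ _ (DX i)).
exists (c *: h' + h); rewrite mulrDr -E -scalerAr -E' linearD linearZ /=.
by rewrite scalerBr addrACA opprD.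
Qed.

(** The forms y - a x and z - b x are a regular sequence, so their syzygies are Koszul: setting z =
    b x kills the second term and forces f to vanish there, so z - b x divides f. *)
Lemma line_division (f g : S) :
  ('X_i1 - a *: 'X_i0) * f + ('X_i2 - b *: 'X_i0) * g = 0 ->
  exists h, f = ('X_i2 - b *: 'X_i0) * h /\ g = - (('X_i1 - a *: 'X_i0) * h).
Proof.
have ne (i : 'I_3) c : i != i0 -> ('X_i - c *: 'X_i0 : S) != 0.
  move=> ii; apply/negP=> /eqP/mpolyP/(_ U_(i)%MM)/eqP.
  rewrite mcoeffB mcoeffZ !mcoeffX eqxx eq_mnm1 (eq_sym i0) (negPf ii) mulr0 subr0.
  by rewrite mcoeff0 oner_eq0.
move=> E; have evf : line_subst f = 0.
  have := congr1 line_subst E.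
  rewrite linearD /= !line_substM !linearB !linearZ /= !line_substX /= !scalerN subrr mul0r.
  by rewrite addr0 linear0 => /eqP; rewrite mulf_eq0 (negPf (ne _ _ _)) // => /eqP.
have [h Eh] := sub_subst_dvd f; rewrite evf subr0 in Eh; exists h; split=> //.
apply: (mulfI (ne i2 b isT)).
have -> : ('X_i2 - b *: 'X_i0) * g = - (('X_i1 - a *: 'X_i0) * f).
  by apply/eqP; rewrite -addr_eq0 addrC E.
by rewrite Eh; ring.
Qed.

End LineDivision.

Section LinearSyzygies.
Variables (k : fieldType) (s : nat) (I : {pred {mpoly k[3]}}).
Hypotheses (s3 : (3 <= s)%N) (idI : idealr_closed I).
Local Notation R := {mpoly k[3]}.
Local Notation X := (Xv k).
Hypothesis highI : forall p, ord_ge (2 * s) p -> p \in I.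
Variable phi : {scalar R}.
Hypothesis phiI : forall p, p \in I -> phi p = 0.
Hypothesis phi_nondeg : forall c,
  (forall p, ord_ge s p -> phi (c * p) = 0) -> ord_ge s c.

Variables (K : fieldType) (iota : {rmorphism k -> K}).
Local Notation S := {mpoly K[3]}.
Local Notation lift := (map_mpoly iota).

(** The K-linear extension of [phi]. The sum may stop below degree 2s because [phi] vanishes on I,
    which contains every monomial of degree at least 2s. *)
Definition ext_phi (f : S) : K :=
  \sum_(m : 'X_{1..3 < 2 * s}) f@_m * iota (phi 'X_[m]).

Lemma ext_phi_is_scalar : scalar ext_phi.
Proof.
move=> a f g; rewrite /ext_phi mulr_sumr -big_split; apply: eq_bigr => m _.
by rewrite mcoeffD mcoeffZ mulrDl mulrA.
Qed.
HB.instance Definition _ := GRing.isLinear.Build K S K _ ext_phi ext_phi_is_scalar.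

Lemma ext_phi_lift p : ext_phi (lift p) = iota (phi p).
Proof.
pose q : R := \sum_(m : 'X_{1..3 < 2 * s}) p@_m *: 'X_[m].
have -> : phi p = phi q.
  apply/eqP; rewrite -subr_eq0 -linearB; apply/eqP/phiI/highI => m lt.
  by rewrite mcoeffB (mcoeff_mpoly (fun m => p@_m)) // subrr.
rewrite /q (linear_sum phi) rmorph_sum; apply: eq_bigr => m _.
by rewrite linearZ rmorphM /= mcoeff_map_mpoly.
Qed.

Lemma liftX (m : 'X_{1..3}) : lift 'X_[m] = 'X_[m].
Proof. exact: map_mpolyX. Qed.

Lemma ext_phi_ideal p f : p \in I -> ext_phi (lift p * f) = 0.
Proof.
move=> Ip; rewrite (mpolyE f) mulr_sumr linear_sum big1 // => m _.
rewrite -scalerAr linearZ -liftX -rmorphM /= ext_phi_lift phiI ?rmorph0 ?mulr0 //.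
exact: ideal_mulr.
Qed.

(** Over [k], nondegeneracy says that the Gram matrix [G] of monomials of degree < s against
    monomials of degree from s to 2s-1 has independent rows. This passes to K, where the low
    coefficients of [f] are a relation between these rows. *)
Lemma ext_phi_nondeg f : (forall m, (s <= mdeg m)%N -> ext_phi (f * 'X_[m]) = 0) ->
  ord_ge s f.
Proof.
move=> Hf.
pose G (m : 'X_{1..3 < s}) (m' : 'X_{1..3 < 2 * s}) : k :=
  if (s <= mdeg m')%N then phi ('X_[m] * 'X_[m']) else 0.
have indG (z : 'X_{1..3 < s} -> k) :
    (forall m', \sum_m z m * G m m' = 0) -> forall m, z m = 0.
  move=> Hz m; pose c : R := \sum_(m : 'X_{1..3 < s}) z m *: 'X_[m].
  have cE (m0 : 'X_{1..3 < s}) : c@_m0 = z m0.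
    rewrite raddf_sum (bigD1 m0) //= mcoeffZ mcoeffX eqxx mulr1 big1 ?addr0 //.
    by move=> m' ne; rewrite mcoeffZ mcoeffX -bmeqP (negPf ne) mulr0.
  rewrite -cE; apply: phi_nondeg (bmdeg m) => p Hp.
  pose q : R := \sum_(m : 'X_{1..3 < 2 * s}) p@_m *: 'X_[m].
  have -> : phi (c * p) = phi (c * q).
    apply/eqP; rewrite -subr_eq0 -linearB -mulrBr; apply/eqP/phiI.
    apply: ideal_mull => //; apply: highI => m' lt.
    by rewrite mcoeffB (mcoeff_mpoly (fun m => p@_m)) // subrr.
  rewrite mulr_sumr linear_sum big1 // => m' _; rewrite -scalerAr linearZ /=.
  have [lt|ge] := ltnP (mdeg m') s; first by rewrite Hp ?mul0r.
  apply/eqP; rewrite mulf_eq0; apply/orP; right; apply/eqP.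
  rewrite -[RHS](Hz m') mulr_suml linear_sum; apply: eq_bigr => m2 _.
  by rewrite /G ge -scalerAl linearZ.
have fG m' : \sum_m f@_(m : 'X_{1..3 < s}) * iota (G m m') = 0.
  rewrite /G; case: leqP => [le|_]; last by rewrite big1 // => m _; rewrite rmorph0 mulr0.
  pose f' : S := \sum_(m : 'X_{1..3 < s}) f@_m *: 'X_[m].
  transitivity (ext_phi (f * 'X_[m'])); last exact: Hf.
  have -> : ext_phi (f * 'X_[m']) = ext_phi (f' * 'X_[m']).
    apply/eqP; rewrite -subr_eq0 -linearB -mulrBl; apply/eqP.
    rewrite [LHS]big1 // => m0 _; have Hm : ord_ge s ('X_[m'] : S).
      by apply: (homog_ord_ge le); rewrite dhomogX.
    have Hff : ord_ge s (f - f').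
      by move=> m1 lt; rewrite mcoeffB (mcoeff_mpoly (fun m => f@_m)) // subrr.
    rewrite (ord_geM Hff Hm) ?mul0r //.
    by apply: leq_trans (bmdeg m0) _; lia.
  rewrite mulr_suml linear_sum; apply: eq_bigr => m _.
  by rewrite -scalerAl linearZ -!liftX -rmorphM /= ext_phi_lift.
move=> m lt.
exact: (free_extension indG (u := fun m : 'X_{1..3 < s} => f@_m) fG (BMultinom lt)).
Qed.

Variable P : 'I_3 -> K.
Hypothesis P0 : P i0 != 0.

(* If [w] is killed, for the extended functional, by the linear forms through [P],
   then the functional [g |-> ext_phi (g * w)] is evaluation at [P] up to scalars;
   it vanishes as soon as some [v] of degree [s] with [v(P) <> 0] annihilates [w]. *)
Lemma eval_functional_ge w v :
  (forall i g, ext_phi (('X_i - (P i / P i0) *: 'X_i0) * w * g) = 0) ->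
  v \is s.-homog -> (forall g, ext_phi (v * g) = 0) -> v.@[P] != 0 -> ord_ge s w.
Proof.
move=> Hw hv Hv vP.
pose Psi g := ext_phi (g * w).
have red i g : P i0 * Psi ('X_i * g) = P i * Psi ('X_i0 * g).
  have := Hw i g; rewrite mulrAC -/(Psi _) => E.
  have : Psi ('X_i * g) = P i / P i0 * Psi ('X_i0 * g).
    apply/eqP; rewrite -subr_eq0 -[X in _ == X]E; apply/eqP.
    by rewrite mulrBl -scalerAl /Psi mulrBl -[(_ *: _) * w]scalerAl linearB linearZ.
  by move=> ->; rewrite mulrA mulrCA mulfV // mulr1.
(* [T d h] says that [h], of degree d, acts on [Psi] as the scalar h(P), in a form homogenized by
   powers of x. The property is multiplicative, so the variables suffice to get all monomials. *)
pose T d (h : S) := forall g, P i0 ^+ d * Psi (h * g) = h.@[P] * Psi ('X_i0 ^+ d * g).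
have TM d e h1 h2 : T d h1 -> T e h2 -> T (d + e)%N (h1 * h2).
  move=> T1 T2 g; rewrite mevalM -[h1 * h2 * g]mulrA exprD [P i0 ^+ d * _]mulrC.
  rewrite -mulrA T1 mulrCA ['X_i0 ^+ d * (h2 * g)]mulrCA T2 mulrA.
  by rewrite [_ * ('X_i0 ^+ d * g)]mulrA -exprD addnC.
have T0 : T 0%N 1 by move=> g; rewrite meval1 !expr0.
have TX i : T 1%N 'X_i by move=> g; rewrite mevalXU !expr1 red.
have Texp i n : T n ('X_i ^+ n).
  elim: n => [|n IH]; first by rewrite expr0.
  by rewrite exprS; exact: (TM 1%N n _ _ (TX i) IH).
have TM2 d h1 e h2 : T d h1 -> T e h2 -> T (d + e)%N (h1 * h2) := @TM d e h1 h2.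
have Tmon m : T (mdeg m) 'X_[m].
  by rewrite mdegE mpolyXE_id; apply: (big_ind2 T T0 TM2) => i _; exact: Texp.
(* All monomials of [v] have degree s, so v(P) times this value is [P i0 ^+ s * Psi (v * g)], which
   vanishes since [v] annihilates everything. *)
have Ps0 g : Psi ('X_i0 ^+ s * g) = 0.
  have vg : Psi (v * g) = \sum_(m <- msupp v) v@_m * Psi ('X_[m] * g).
    rewrite {1}(mpolyE v) /Psi !mulr_suml linear_sum; apply: eq_bigr => m _.
    by rewrite -!scalerAl linearZ.
  have : v.@[P] * Psi ('X_i0 ^+ s * g) = P i0 ^+ s * Psi (v * g).
    rewrite vg mevalE mulr_suml mulr_sumr big_seq [RHS]big_seq.
    apply: eq_bigr => m mv; have := Tmon m g; rewrite (dhomog_mf hv mv) => E.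
    by rewrite [RHS]mulrCA E mevalX mulrA.
  by rewrite {2}/Psi -mulrA Hv mulr0 => /eqP; rewrite mulf_eq0 (negPf vP) => /eqP.
apply: ext_phi_nondeg => m le; have := Tmon m 1.
have -> : 'X_i0 ^+ mdeg m * 1 = 'X_i0 ^+ s * 'X_i0 ^+ (mdeg m - s) :> S.
  by rewrite mulr1 -exprD subnKC.
rewrite Ps0 mulr0 mulr1.
by move/eqP; rewrite mulf_eq0 expf_eq0 (negPf P0) andbF /Psi mulrC => /eqP.
Qed.

End LinearSyzygies.

(** The relation at [P] eliminates [o i0], which turns the syzygy of X into one of the two linear
    forms that cut out [P]. *)
Lemma line_division_point (K : fieldType) (P : 'I_3 -> K) (o : 'I_3 -> {mpoly K[3]}) :
  P i0 != 0 -> \sum_i 'X_i * o i = 0 -> \sum_i P i *: o i = 0 ->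
  exists h, [/\ o i0 = - ((P i1 / P i0) *: o i1 + (P i2 / P i0) *: o i2),
                o i1 = ('X_i2 - (P i2 / P i0) *: 'X_i0) * h
              & o i2 = - (('X_i1 - (P i1 / P i0) *: 'X_i0) * h)].
Proof.
rewrite !sum_ord3 => P0 oX oP.
have o0 : o i0 = - ((P i1 / P i0) *: o i1 + (P i2 / P i0) *: o i2).
  apply: (scalerI P0); rewrite scalerN scalerDr !scalerA.
  rewrite ![P i0 * _]mulrC !mulfVK //; apply/eqP; rewrite -addr_eq0 addrA.
  exact/eqP.
have [|h [? ?]] := @line_division K (P i1 / P i0) (P i2 / P i0) (o i1) (o i2).
  move: oX; rewrite o0; move: (o i1) (o i2) (_ / _) (_ / _) => f g a b <-.
  by rewrite -!mul_mpolyC; ring.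
by exists h.
Qed.

Section GenericPoint.
Variables (k : fieldType) (s : nat) (I : {pred {mpoly k[3]}}).
Hypotheses (s3 : (3 <= s)%N) (idI : idealr_closed I).
Local Notation R := {mpoly k[3]}.
Local Notation vec := {ffun 'I_3 -> R}.
Local Notation X := (Xv k).
Hypothesis highI : forall p, ord_ge (2 * s) p -> p \in I.
Variable phi : {scalar R}.
Hypothesis phiI : forall p, p \in I -> phi p = 0.
Hypothesis phi_nondeg : forall c,
  (forall p, ord_ge s p -> phi (c * p) = 0) -> ord_ge s c.

Variables (K : fieldType) (tau : {rmorphism R -> K}) (iota : {rmorphism k -> K}).
Hypothesis tau_eq0 : forall p, (tau p == 0) = (p == 0).
Hypothesis iotaE : forall c, iota c = tau c%:MP.
Local Notation S := {mpoly K[3]}.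
Local Notation lift := (map_mpoly iota).

(** With K the fraction field of R and [tau] the inclusion, evaluation here is injective on
    polynomials over [k]: a nonzero element of I does not vanish at this point, however small [k]
    is. *)
Definition generic_point (i : 'I_3) : K := tau ('X_i : R).

Lemma lift_generic_point p : (lift p).@[generic_point] = tau p.
Proof.
elim/mpolyind: p => [|c m p _ _ IH]; first by rewrite !rmorph0.
rewrite !rmorphD /= IH -mul_mpolyC !rmorphM /=; congr (_ + _).
rewrite map_mpolyC mevalC; congr (_ * _); first exact: iotaE.
rewrite map_mpolyX mevalX mpolyXE_id rmorph_prod.
by apply: eq_bigr => i _; rewrite rmorphXn.
Qed.

Lemma generic_point_neq0 i : generic_point i != 0.
Proof. by rewrite tau_eq0 mpolyXU_neq0. Qed.

Lemma lift_homog d (p : R) : p \is d.-homog -> lift p \is d.-homog.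
Proof.
move/homogP0=> hp; apply/homogP0 => m /hp E.
by rewrite mcoeff_map_mpoly E; exact: rmorph0.
Qed.

Lemma linear_syzygies_lt n (w : 'I_n -> vec) (v : 'I_s -> R) :
  basis_mod (fun p => p \is s.-homog /\ p \in I) (fun p => p = 0) v ->
  (forall j, hom3 s.-1 (w j)) -> (forall j, cyc2 I (w j)) ->
  (forall z : 'I_n -> k, cross X (\sum_j z j *: w j) = 0 -> forall j, z j = 0) ->
  (n < s)%N.
Proof.
move=> [Vv spv indv] hw Cw indw; rewrite ltnNge; apply/negP=> le.
have s1 : (1 + s.-1)%N = s by rewrite add1n prednK //; lia.
have hy j : hom3 s (cross X (w j)) by rewrite -s1; apply: cross_hom3 (hom3_Xv k) _.
have [C HC] := fin_all_exists (fun ja : 'I_n * 'I_3 =>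
  spv _ (conj (hy ja.1 ja.2) (Cw ja.1 ja.2))).
have {}HC j a : cross X (w j) a = \sum_i C (j, a) i *: v i.
  by apply/eqP; rewrite -subr_eq0; apply/eqP; exact: (HC (j, a)).
(* Row j of [M] holds the coefficients of P . (X x w_j) on the basis [v] of I_s, with P substituted
   in the outer factor only. Substituting P in [v] as well gives P . (P x w_j(P)) = 0, that is,
   [M *m vc = 0]. *)
pose M := \matrix_(j < n, i < s) \sum_a generic_point a * iota (C (j, a) i).
pose vc := \col_(i < s) tau (v i).
have Mv : M *m vc = 0.
  apply/colP=> j; rewrite !mxE.
  transitivity (tau (dot X (cross X (w j)))); last first.
    by rewrite dot_crossr rmorph0.
  transitivity (\sum_a generic_point a * tau (cross X (w j) a)); last first.
    by rewrite /dot !rmorphD !rmorphM sum_ord3 !XvE.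
  under eq_bigr do rewrite !mxE mulr_suml.
  rewrite exchange_big; apply: eq_bigr => a _; rewrite HC rmorph_sum mulr_sumr.
  apply: eq_bigr => i _; rewrite -mul_mpolyC rmorphM /= -iotaE; ring.
have s_gt0 : (0 < s)%N by lia.
have v_neq0 i : v i != 0.
  apply/eqP=> vi; have := indv (fun l => (l == i)%:R) _ i.
  rewrite eqxx => H; case/eqP: (oner_neq0 k); apply: H.
  rewrite big1 // => l _; case: eqP => [->|_]; last by rewrite scale0r.
  by rewrite vi scaler0.
pose i00 := Ordinal s_gt0.
(* If the rows of [M] were independent, s <= n would give [M] full column rank, and [M *m vc = 0]
   would force [vc = 0]. *)
have [u u0 uM] : exists2 u : 'rV_n, u != 0 & u *m M = 0.
  have [fM|] := boolP (row_free M); last first.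
    by rewrite -kermx_eq0 => /rowV0Pn[u /sub_kermxP uM u0]; exists u.
  have /row_fullP[B BM] : row_full M.
    move: fM; rewrite /row_free /row_full => /eqP rM.
    by rewrite eqn_leq rank_leq_col rM.
  have: vc = 0 by rewrite -[vc]mul1mx -BM -mulmxA Mv mulmx0.
  move/colP/(_ i00); rewrite !mxE => /eqP.
  by rewrite tau_eq0 (negPf (v_neq0 _)).
(* The combination of the vectors X x w_j with coefficients [u]. It is orthogonal to X identically,
   and to [P] by the choice of [u]. *)
pose om a : S := \sum_j u 0 j *: lift (cross X (w j) a).
have omX : \sum_a 'X_a * om a = 0.
  under eq_bigr do rewrite mulr_sumr.
  rewrite exchange_big big1 // => j _.
  under eq_bigr do rewrite -scalerAr.
  rewrite -scaler_sumr; suff -> : \sum_a 'X_a * lift (cross X (w j) a) = 0.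
    by rewrite scaler0.
  transitivity (lift (dot X (cross X (w j)))); last by rewrite dot_crossr rmorph0.
  by rewrite /dot !rmorphD !rmorphM /= sum_ord3 !XvE !map_mpolyX.
have omP : \sum_a generic_point a *: om a = 0.
  transitivity (\sum_i (u *m M) 0 i *: lift (v i)); last first.
    by rewrite uM big1 // => i _; rewrite mxE scale0r.
  have -> : \sum_i (u *m M) 0 i *: lift (v i) = \sum_a \sum_j \sum_i
      (u 0 j * (generic_point a * iota (C (j, a) i))) *: lift (v i).
    rewrite exchange_big /=; under [RHS]eq_bigr do rewrite exchange_big.
    rewrite exchange_big /=; apply: eq_bigr => i _.
    rewrite !mxE scaler_suml; apply: eq_bigr => j _.
    by rewrite mxE mulr_sumr scaler_suml.
  apply: eq_bigr => a _; rewrite scaler_sumr; apply: eq_bigr => j _.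
  rewrite HC rmorph_sum !scaler_sumr; apply: eq_bigr => i _.
  by rewrite /= map_mpolyZ !scalerA; congr (_ *: _); ring.
have omPhi a f : ext_phi s phi iota (om a * f) = 0.
  rewrite mulr_suml linear_sum big1 // => j _; rewrite -scalerAl linearZ /=.
  by rewrite (ext_phi_ideal idI highI phiI) ?mulr0 //; apply: Cw.
have omh a : om a \is s.-homog.
  apply: (subspace_comb (subspace_homog K s)) => j.
  exact: (lift_homog (hy j a)).
pose P := generic_point.
have P0 := generic_point_neq0 i0.
have [h [om0 E1 E2]] := line_division_point P0 omX omP.
have hge : ord_ge s h.
  apply: (@eval_functional_ge k s I s3 idI highI phi phiI phi_nondeg K iota
    P P0 h (lift (v i00))).
  - elim/ord3P => g.
    + by rewrite mulfV // scale1r subrr mul0r mul0r linear0.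
    + have := omPhi i2 g; rewrite E2 mulNr linearN => /eqP.
      by rewrite oppr_eq0 => /eqP.
    + by have := omPhi i1 g; rewrite E1.
  - by apply: lift_homog; case: (Vv i00).
  - move=> g; apply: (ext_phi_ideal idI highI phiI); by case: (Vv i00).
  - by rewrite lift_generic_point tau_eq0.
have hl (i : 'I_3) c : ord_ge 1 ('X_i - c *: 'X_i0 : S).
  apply: (subspaceB (subspace_ord_ge K 1)); last apply: (subspaceZ (subspace_ord_ge K 1));
  by apply: homog_ord_ge (dhomogXU _ _).
(* Since [h] has order at least s, the coordinates of [om] have order at least s+1, although they
   are homogeneous of degree s. *)
have zero (f : S) : f \is s.-homog -> ord_ge (1 + s) f -> f = 0.
  move=> /homogP0 hf gf; apply/mpolyP=> m; rewrite mcoeff0.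
  have [E|/hf //] := eqVneq (mdeg m) s.
  by apply: gf; rewrite E.
have om1 : om i1 = 0 by apply: zero => //; rewrite E1; apply: ord_geM.
have om2 : om i2 = 0.
  apply: zero => //; rewrite E2 -[- _]sub0r.
  have sP := subspace_ord_ge K (1 + s).
  by apply: (subspaceB sP); [apply: subspace0 sP | apply: ord_geM].
have oma a : om a = 0.
  elim/ord3P: a; [|exact: om1|exact: om2].
  by rewrite om0 om1 om2 !scaler0 addr0 oppr0.
have ZE c (f : vec) a : (c *: f) a = c *: f a by rewrite ffunE.
(* The vanishing of [om] is a K-linear relation between the coefficient families of the X x w_j,
   which are independent over [k]; hence [u] is zero. *)
pose Y (j : 'I_n) (am : 'I_3 * 'X_{1..3 < s.+1}) := (cross X (w j) am.1)@_am.2.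
case/negP: u0; apply/eqP/rowP=> j; rewrite [RHS]mxE.
apply: (@free_extension k K iota _ _ Y _ (fun j => u 0 j)) => [z Hz|[a m]].
  apply: indw; rewrite cross_comb.
  apply/ffunP=> a; rewrite sum_ffunE ffunE; apply/mpolyP=> m.
  rewrite raddf_sum mcoeff0 /=.
  have [lt|ge] := ltnP (mdeg m) s.+1.
    rewrite -[RHS](Hz (a, BMultinom lt)); apply: eq_bigr => j' _.
    by rewrite ZE mcoeffZ.
  rewrite big1 // => j' _; rewrite ZE mcoeffZ.
  by rewrite (dhomog_nemf_coeff (hy j' a)) ?mulr0 // neq_ltn ge orbT.
have := congr1 (mcoeff m) (oma a); rewrite mcoeff0 raddf_sum /= => E.
rewrite -[RHS]E; apply: eq_bigr => j' _.
by rewrite mcoeffZ mcoeff_map_mpoly.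
Qed.

End GenericPoint.

(** * Dimensions of Tor and minimal generators *)

(** The homology at the middle of a complex given by matrices [E] and [D] has dimension n - rank D -
    rank E. Composition with [cokermx E] turns a cycle into coordinates of its class, and the basis
    is drawn from [H]. *)
Lemma homology_basis (F : fieldType) (M : lmodType F) n p q
    (c : {linear M -> 'rV[F]_n}) (D : 'M[F]_(n, p)) (E : 'M[F]_(q, n))
    (cyc bnd H : M -> Prop) :
  (forall x, exists u, c u = x) -> E *m D = 0 ->
  (forall u, cyc u <-> c u *m D = 0) -> (forall u, bnd u <-> (c u <= E)%MS) ->
  (forall u, H u -> cyc u) ->
  (forall u, cyc u -> exists h h', [/\ H h, H h' & bnd (u - (h + h'))]) ->
  exists m (b : 'I_m -> M),
    [/\ (m + \rank D + \rank E)%N = n, forall i, H (b i) & basis_mod cyc bnd b].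
Proof.
move=> surj ED cycP bndP Hcyc spH.
have lt : linear (fun u => c u *m cokermx E) by move=> a u v; rewrite linearP mulmxDl scalemxAl.
pose t := to_linear lt; pose Z := kermx D *m cokermx E.
have tE u : t u = c u *m cokermx E by [].
have t0 u : t u = 0 <-> bnd u by rewrite tE bndP submxE; split=> /eqP.
have [v|u|u|m [b [rm Hb bb]]] := @basis_mod_coords F M n t cyc H _ Z.
- split=> [/submxP[x ->]|[u /cycP uD <-]].
    have [u cu] := surj (x *m kermx D); exists u.
      by apply/cycP; rewrite cu -mulmxA mulmx_ker mulmx0.
    by rewrite tE cu /Z mulmxA.
  by rewrite tE /Z submxMr //; apply/sub_kermxP.
- exact: Hcyc.
- move/spH=> [h [h' [Hh Hh' /t0]]]; rewrite linearB linearD /= => /eqP.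
  by rewrite subr_eq0 => /eqP; exists h, h'.
exists m, b; split=> //; last by apply: eq_basis_mod bb.
have := mxrank_mul_ker (kermx D) (cokermx E); rewrite -/Z -rm.
have -> : \rank (kermx D :&: kermx (cokermx E))%MS = \rank E.
  have EK : (E <= kermx D)%MS by apply/sub_kermxP.
  have eqE : (kermx (cokermx E) :=: E)%MS.
    apply/eqmxP/andP; split; last by apply/sub_kermxP; rewrite mulmx_coker.
    by rewrite submxE mulmx_ker.
  by rewrite (cap_eqmx (eqmx_refl _) eqE) (capmx_idPr EK).
by rewrite mxrank_ker addnAC => ->; rewrite subnK ?rank_leq_row.
Qed.

Section TorDims.
Variables (k : fieldType) (s : nat) (I : {pred {mpoly k[3]}}).
Hypotheses (s3 : (3 <= s)%N) (idI : idealr_closed I).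
Local Notation R := {mpoly k[3]}.
Local Notation vec := {ffun 'I_3 -> R}.
Local Notation X := (Xv k).
Implicit Types p q : R.
Implicit Types u v w : vec.
Hypothesis lowI : forall p, p \in I -> ord_ge s p.
Variables b0 b1 : R.
Hypotheses (sb0 : in_socle I b0) (sb1 : in_socle I b1).
Hypothesis soc_span : forall p, in_socle I p ->
  exists c0 c1, p - (c0 *: b0 + c1 *: b1) \in I.
Hypothesis soc_indep : forall c0 c1, c0 *: b0 + c1 *: b1 \in I -> c0 = 0 /\ c1 = 0.
Variables (N : nat) (pi : {linear R -> 'rV[k]_N}).
Hypotheses (pi_surj : forall x, exists p, pi p = x).
Hypotheses (pi_ker : forall p, pi p = 0 <-> p \in I).
Local Notation c3 := (coords3 pi).

Lemma coords_Koszul : exists (D1 : 'M_(N + (N + N), N)) (D2 : 'M_(N + (N + N)))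
  (D3 : 'M_(N, N + (N + N))),
  [/\ forall u, pi (dot X u) = c3 u *m D1, forall w, c3 (cross X w) = c3 w *m D2
    & forall p, c3 (scale3 p X) = pi p *m D3].
Proof.
have c3s := coords3_surj pi_surj; have c3k := coords3_ker pi_ker.
have l1 : linear (fun u => pi (dot X u)) by move=> a u v; rewrite linear_dot linearP.
have l2 : linear (fun u => c3 (cross X u)) by move=> a u v; rewrite linear_cross linearP.
have l3 : linear (fun p => c3 (scale3 p X)) by move=> a u v; rewrite scale3_is_linear linearP.
have [D1 H1] : exists D1, forall u, to_linear l1 u = c3 u *m D1.
  by apply: factor_mx => // u /c3k Iu /=; apply/pi_ker/ideal_dot.
have [D2 H2] : exists D2, forall u, to_linear l2 u = c3 u *m D2.
  by apply: factor_mx => // u /c3k Iu /=; apply/c3k/cross_inI3.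
have [D3 H3] : exists D3, forall p, to_linear l3 p = pi p *m D3.
  apply: factor_mx => // p /pi_ker Ip /=; apply/c3k => i.
  by rewrite ffunE; apply: ideal_mulr.
by exists D1, D2, D3.
Qed.

(** The image of [D1] is R_+/I, the kernel of the constant term; the constant term is well defined
    on R/I since I has positive order. *)
Lemma rank_D1 (D1 : 'M_(N + (N + N), N)) :
  (forall u, pi (dot X u) = c3 u *m D1) -> (\rank D1).+1 = N.
Proof.
move=> HD1.
have l0 : linear (fun p : R => const_mx (p@_0%MM) : 'rV[k]_1).
  by move=> a u v; apply/rowP=> i; rewrite !mxE mcoeffD mcoeffZ.
have [E HE] : exists E, forall p, to_linear l0 p = pi p *m E.
  apply: factor_mx => // p /pi_ker/lowI Hp /=.
  by apply/rowP=> i; rewrite !mxE; apply: Hp; rewrite mdeg0; lia.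
have eqD : (kermx E == D1)%MS.
  apply/andP; split; apply/row_subP=> i.
    have := row_sub i (kermx E); move: (row i _) => x /sub_kermxP xE.
    have [p px] := pi_surj x; have := HE p; rewrite px xE => /rowP/(_ 0).
    rewrite !mxE => /Rplus_decomp[u pu]; rewrite -px pu HD1.
    exact: submxMl.
  have := row_sub i D1 => /submxP[x ->]; apply/sub_kermxP.
  have [u cu] := coords3_surj pi_surj x; rewrite -cu -HD1 -HE /=.
  apply/rowP=> j; rewrite !mxE /dot !XvE !mcoeffD ![('X_ _ * _)@_0]mcoeffXM.
  by rewrite !mnm0E eqxx !addr0.
have rE : \rank E = 1%N.
  apply/eqP; rewrite eqn_leq rank_leq_col lt0n mxrank_eq0; apply/eqP=> E0.
  have := HE 1; rewrite E0 mulmx0 => /rowP/(_ 0); rewrite !mxE mcoeff1 eqxx => /eqP.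
  by rewrite oner_eq0.
have N0 : (0 < N)%N by rewrite -rE rank_leq_row.
rewrite -(eqmxP eqD) mxrank_ker rE; lia.
Qed.

(** The kernel of [D3] is the socle, with basis [b0], [b1]. *)
Lemma rank_D3 (D3 : 'M_(N, N + (N + N))) :
  (forall p, c3 (scale3 p X) = pi p *m D3) -> (\rank D3).+2 = N.
Proof.
move=> HD3; pose B : 'M[k]_(1 + 1, N) := col_mx (pi b0) (pi b1).
have BE (x : 'rV_(1 + 1)) : x *m B = pi (lsubmx x 0 0 *: b0 + rsubmx x 0 0 *: b1).
  rewrite -{1}[x]hsubmxK mul_row_col linearD !linearZ /=.
  have sc (y : 'M_1) p : y *m pi p = y 0 0 *: pi p.
    by rewrite {1}[y]mx11_scalar mul_scalar_mx.
  by rewrite !sc.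
have eqD : (kermx D3 == B)%MS.
  apply/andP; split; apply/row_subP=> i.
    have := row_sub i (kermx D3); move: (row i _) => x /sub_kermxP xE.
    have [p px] := pi_surj x; move: xE; rewrite -px -HD3 => /(coords3_ker pi_ker) Ip.
    have [|c0 [c1 H]] := @soc_span p.
      by apply/in_socleXP => // j; rewrite mulrC -XvE; have := Ip j; rewrite ffunE.
    have -> : pi p = row_mx (const_mx c0 : 'M_1) (const_mx c1 : 'M_1) *m B.
      rewrite BE row_mxKl row_mxKr !mxE; apply/eqP.
      by rewrite -subr_eq0 -linearB; apply/eqP/pi_ker.
    exact: submxMl.
  have := row_sub i B => /submxP[x ->]; apply/sub_kermxP; rewrite BE -HD3.
  apply/(coords3_ker pi_ker) => j; rewrite ffunE XvE mulrC.
  move: j; apply/(in_socleXP idI) => q q0.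
  by rewrite mulrDr -!scalerAr; apply: idealD => //; apply: idealZ => //; [apply: sb0|apply: sb1].
have rB : \rank B = 2.
  apply/eqP; rewrite -[_ == _]/(row_free B) -kermx_eq0; apply/eqP/row_matrixP=> i.
  rewrite row0; have := row_sub i (kermx B); move: (row i _) => x /sub_kermxP.
  rewrite BE => /pi_ker/soc_indep[x0 x1].
  rewrite -[x]hsubmxK; apply/eqP; rewrite row_mx_eq0; apply/andP.
  by split; apply/eqP/matrixP=> a b; rewrite !ord1 [RHS]mxE ?x0 ?x1.
have eqDB := eqmxP eqD; have := mxrank_ker D3; rewrite eqDB rB; lia.
Qed.

(** In the difference of the two dimensions the rank of [D2] cancels: dim Tor_2 - dim Tor_1 = rank
    D1 - rank D3 = (N-1) - (N-2) = 1, and 1 is written as 2 - 1, with 2 the type. *)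
Lemma tor_bases (H1 H2 : vec -> Prop) :
  (forall u, H1 u -> cyc1 I u) -> (forall w, H2 w -> cyc2 I w) ->
  (forall u, cyc1 I u -> exists h h', [/\ H1 h, H1 h' & bnd1 I (u - (h + h'))]) ->
  (forall u, cyc2 I u -> exists h h', [/\ H2 h, H2 h' & bnd2 I (u - (h + h'))]) ->
  exists m (e : 'I_m -> vec) (f : 'I_(m + 2 - 1) -> vec),
    [/\ forall i, H1 (e i), forall j, H2 (f j),
        basis_mod (cyc1 I) (bnd1 I) e & basis_mod (cyc2 I) (bnd2 I) f].
Proof.
move=> H1c H2c sp1 sp2.
have [D1 [D2 [D3 [HD1 HD2 HD3]]]] := coords_Koszul.
have c3s := coords3_surj pi_surj; have c3k := coords3_ker pi_ker.
have [|u|w|//|//|m [e [em He be]]] :=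
    @homology_basis k vec _ _ _ c3 D1 D2 (cyc1 I) (bnd1 I) H1 c3s.
- apply/row_matrixP=> i; rewrite row0 row_mul.
  have /submxP[x ->] := row_sub i D2; have [w <-] := c3s x.
  by rewrite -HD2 -HD1 dot_crossr linear0.
- by rewrite -HD1 pi_ker.
- split=> [[v /c3k]|/submxP[x]].
    rewrite linearB /= => /eqP; rewrite subr_eq0 => /eqP ->.
    by rewrite HD2 submxMl.
  have [v <-] := c3s x; rewrite -HD2 => E; exists v; apply/c3k.
  by rewrite linearB /= E subrr.
have [|u|w|//|//|m2 [f [fm Hf bf]]] :=
    @homology_basis k vec _ _ _ c3 D2 D3 (cyc2 I) (bnd2 I) H2 c3s.
- apply/row_matrixP=> i; rewrite row0 row_mul.
  have /submxP[x ->] := row_sub i D3; have [w <-] := pi_surj x.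
  by rewrite -HD3 -HD2 cross_scale linear0.
- by rewrite -HD2 c3k.
- split=> [[v /c3k]|/submxP[x]].
    rewrite linearB /= => /eqP; rewrite subr_eq0 => /eqP ->.
    by rewrite HD3 submxMl.
  have [v <-] := pi_surj x; rewrite -HD3 => E; exists v; apply/c3k.
  by rewrite linearB /= E subrr.
have E : m2 = (m + 2 - 1)%N.
  have := rank_D1 HD1; have := rank_D3 HD3; lia.
by move: f Hf bf; rewrite E => f Hf bf; exists m, e, f.
Qed.

End TorDims.

Lemma in_spanP (k : fieldType) (a : seq {mpoly k[3]}) p :
  in_span a p <-> exists c : nat -> {mpoly k[3]}, p = \sum_(0 <= i < size a) c i * a`_i.
Proof.
split=> [[c ->]|[c ->]].
  exists (fun n => if insub n is Some i then c i else 0).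
  by rewrite big_mkord; apply: eq_bigr => i _; rewrite valK.
by exists (fun i => c i); rewrite big_mkord.
Qed.

Lemma subfamily_indep (F : fieldType) (M : lmodType F) (W : M -> Prop) m
    (b : 'I_m -> M) (A : pred 'I_m) :
  (forall c : 'I_m -> F, W (\sum_i c i *: b i) -> forall i, c i = 0) ->
  forall z : 'I_#|A| -> F, W (\sum_l z l *: b (enum_val l)) -> forall l, z l = 0.
Proof.
move=> ind z Wz l; pose c i := \sum_(l | enum_val l == i) z l.
have <- : c (enum_val l) = z l.
  by rewrite /c (big_pred1 l) // => l'; rewrite (inj_eq enum_val_inj).
apply: ind; suff -> : \sum_i c i *: b i = \sum_l z l *: b (enum_val l) by [].
under eq_bigr do rewrite scaler_suml.
rewrite (exchange_big_dep predT) //=; apply: eq_bigr => l' _.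
by rewrite (big_pred1 (enum_val l')).
Qed.

Lemma rank_rows_support (F : fieldType) m n (B : 'M[F]_(m, n)) (A : pred 'I_m) :
  (forall i, ~~ A i -> row i B = 0) -> (\rank B <= #|A|)%N.
Proof.
move=> HB; pose C := \matrix_(l < #|A|) row (enum_val l) B.
apply: leq_trans (rank_leq_row C); apply/mxrankS/row_subP=> i.
have [Ai|/HB ->] := boolP (A i); last exact: sub0mx.
have -> : row i B = row (enum_rank_in Ai i) C by rewrite rowK enum_rankK_in.
exact: row_sub.
Qed.

Section Generators.
Variables (k : fieldType) (s : nat) (I : {pred {mpoly k[3]}}).
Hypotheses (s3 : (3 <= s)%N) (idI : idealr_closed I) (homI : homogeneous_ideal I).
Local Notation R := {mpoly k[3]}.
Local Notation vec := {ffun 'I_3 -> R}.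
Local Notation X := (Xv k).
Implicit Types p q : R.
Implicit Types u v w : vec.
Hypothesis lowI : forall p, p \in I -> ord_ge s p.
Variables (m : nat) (e : 'I_m -> vec).
Hypothesis be : basis_mod (cyc1 I) (bnd1 I) e.

Lemma ideal_dot_Xv p : p \in I -> exists2 u, p = dot X u & cyc1 I u.
Proof.
move=> Ip; have [|u pu] := @Rplus_decomp k p.
  by apply: lowI Ip _ _; rewrite mdeg0; lia.
by exists u; rewrite // /cyc1 -pu.
Qed.

(** Graded Nakayama by induction on the degree. Write p = X . u and expand the cycle [u] on [e]: the
    boundary contributes nothing, and the remainder, with entries in I, contributes x_i times
    elements of I of one degree less. *)
Lemma generators_graded : (forall i, middle s (e i)) ->
  forall p, p \in I -> exists c : 'I_m -> R, p = \sum_i c i * dot X (e i).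
Proof.
move=> he; pose G p := exists c : 'I_m -> R, p = \sum_i c i * dot X (e i).
have GD p q : G p -> G q -> G (p + q).
  move=> [c ->] [c' ->]; exists (fun i => c i + c' i).
  by rewrite -big_split; apply: eq_bigr => i _; rewrite mulrDl.
have GM a p : G p -> G (a * p).
  move=> [c ->]; exists (fun i => a * c i).
  by rewrite mulr_sumr; apply: eq_bigr => i _; rewrite mulrA.
have G0 : G 0 by exists (fun=> 0); rewrite big1 // => i _; rewrite mul0r.
have Ge i : G (dot X (e i)).
  exists (fun j => (j == i)%:R); rewrite (bigD1 i) //= eqxx mul1r big1 ?addr0 //.
  by move=> j /negPf ->; rewrite mul0r.
have Gsum n (f : 'I_n -> R) : (forall i, G (f i)) -> G (\sum_i f i).
  by move=> Gf; apply: (big_ind G G0 GD) => i _; apply: Gf.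
have Ghom d : forall p, p \is d.-homog -> p \in I -> G p.
  elim: d => [|d IH] p hp Ip.
    rewrite (_ : p = 0) //; apply: (@ord_ge_eq0 _ s); first exact: lowI.
    rewrite msizeE; apply/bigmax_leqP_seq => m' mp _.
    by rewrite (dhomog_mf hp mp); lia.
  have [u pu Cu] := ideal_dot_Xv Ip.
  have [_ sp _] := be; have [c [w Hw]] := sp u Cu.
  rewrite -(pihomog_dE hp).
  have -> : p = \sum_i c i *: dot X (e i) + dot X (u - \sum_i c i *: e i - cross X w).
    by rewrite !dotBr dot_crossr subr0 dot_comb -pu addrC subrK.
  move: (u - _ - _) Hw => v Iv; rewrite linearD linear_sum /=; apply/GD.
    apply: Gsum => i; rewrite linearZ /= -mul_mpolyC; apply: GM.
    have [d' hd'] : exists d', dot X (e i) \is d'.-homog.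
      by case: (he i) => /(dot_hom3 (hom3_Xv k)); [exists (1 + s.-1)%N | exists (1 + s)%N].
    have [<-|ne] := eqVneq d' d.+1; first by rewrite pihomog_dE.
    by rewrite (pihomog_ne0 ne hd').
  rewrite -dot_Xv_pihomog3 /dot; apply/GD; [apply/GD|]; apply/GM; rewrite ffunE;
    by apply: IH; [apply: pihomogP | apply: homI].
move=> p Ip; rewrite (pihomog_partitionE (leqnn (msize p))).
by apply: Gsum => d; apply: (Ghom d); [apply: pihomogP | apply: homI].
Qed.

(** If the generators were fewer than m, some nonzero combination of the X . e_i would have all its
    coefficients on [a] in R_+. It would then equal X . y with [y] in I^3, and exactness over R
    would make the same combination of the [e i] a boundary. The generators need not be
    homogeneous. *)
Lemma leq_num_gens (a : seq R) : generates a I -> (m <= size a)%N.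
Proof.
move=> ga; case: be => Ce _ ind; rewrite leqNgt; apply/negP=> lt.
have aI (j : 'I_(size a)) : a`_j \in I.
  apply/ga/in_spanP; exists (fun i : nat => (i == val j)%:R).
  rewrite (bigD1_seq (val j)) ?iota_uniq ?mem_index_iota //= eqxx mul1r big1 ?addr0 //.
  by move=> i /negPf ->; rewrite mul0r.
have [c Hc] := fin_all_exists (fun i => (ga _).1 (Ce i)).
have [z z0 zC] := ltn_dependent (\matrix_(i, j) (c i j)@_0%MM) lt.
have c'0 (j : 'I_(size a)) : (\sum_i z 0 i *: c i j)@_0%MM = 0.
  move/rowP/(_ j): zC; rewrite !mxE raddf_sum /= => E.
  by rewrite -[RHS]E; apply: eq_bigr => i _; rewrite mcoeffZ mxE.
have [g Hg] := fin_all_exists (fun j => Rplus_decomp (c'0 j)).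
case/negP: z0; apply/eqP/rowP=> i; rewrite [RHS]mxE.
pose y : vec := \sum_(j < size a) scale3 a`_j (g j).
have yI : inI3 I y.
  apply: (subspace_sum (subspace_inI3 idI)) => j l; rewrite ffunE.
  exact: ideal_mulr.
apply: (ind (fun i => z 0 i)).
have dy : dot X y = \sum_(j < size a) a`_j * dot X (g j).
  rewrite /y -[dot X _]/(to_linear (linear_dot X) _) linear_sum.
  by apply: eq_bigr => j _; rewrite -dot_scaler.
have : dot X (\sum_i z 0 i *: e i - y) = 0.
  rewrite dotBr dot_comb dy; apply/eqP; rewrite subr_eq0; apply/eqP.
  under eq_bigr do rewrite Hc scaler_sumr.
  rewrite exchange_big; apply: eq_bigr => j _; rewrite -Hg mulr_sumr.
  by apply: eq_bigr => i' _; rewrite [RHS]mulrC -scalerAl.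
case/dot_Xv_eq0=> w Ew; exists w; rewrite -Ew opprB addrC subrK.
exact: yI.
Qed.

Lemma min_num_gens_tor : (forall i, middle s (e i)) -> min_num_gens I m.
Proof.
move=> he; split; last exact: leq_num_gens.
pose a := [seq dot X (e i) | i <- enum 'I_m].
have sa : size a = m by rewrite size_map size_enum_ord.
have aE (i : 'I_m) : a`_i = dot X (e i).
  rewrite (nth_map i); last by rewrite size_enum_ord ltn_ord.
  by congr (dot X (e _)); exact: nth_ord_enum.
have Ce : forall i, cyc1 I (e i) by case: be.
exists a; split=> // p; split=> [/(generators_graded he)[c ->]|/in_spanP[c ->]].
  apply/in_spanP; exists (fun n => if insub n is Some i then c i else 0).
  by rewrite sa big_mkord; apply: eq_bigr => i _; rewrite valK aE.
rewrite sa big_mkord; apply: (subspace_sum (subspace_ideal idI)) => i.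
by rewrite aE; apply: ideal_mull => //; apply: Ce.
Qed.

End Generators.

(** * Rank of the pairing *)

Section PairingRank.
Variables (k : fieldType) (s : nat) (I : {pred {mpoly k[3]}}).
Hypotheses (s3 : (3 <= s)%N) (idI : idealr_closed I) (homI : homogeneous_ideal I).
Local Notation R := {mpoly k[3]}.
Local Notation vec := {ffun 'I_3 -> R}.
Local Notation X := (Xv k).
Implicit Types p q : R.
Implicit Types u w : vec.
Hypothesis lowI : forall p, p \in I -> ord_ge s p.
Hypothesis highI : forall p, ord_ge (2 * s) p -> p \in I.
Variables (N : nat) (pi : {linear R -> 'rV[k]_N}).
Hypotheses (pi_surj : forall x, exists p, pi p = x).
Hypotheses (pi_ker : forall p, pi p = 0 <-> p \in I).
Variable phi : {scalar R}.
Hypothesis phiI : forall p, p \in I -> phi p = 0.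
Hypothesis phiP : forall p, phi p = phi (pihomog mdeg (2 * s - 1) p).
Hypothesis ideal_of_phi : forall p,
  ord_ge s.+1 p -> (forall c, phi (p * c) = 0) -> p \in I.
Hypothesis phi_nondeg : forall c,
  (forall p, ord_ge s p -> phi (c * p) = 0) -> ord_ge s c.
Variable v : 'I_s -> R.
Hypothesis bv : basis_mod (fun p => p \is s.-homog /\ p \in I) (fun p => p = 0) v.

Variables (m n : nat) (e : 'I_m -> vec) (f : 'I_n -> vec).
Hypotheses (be : basis_mod (cyc1 I) (bnd1 I) e) (bf : basis_mod (cyc2 I) (bnd2 I) f).

Definition pairing_mx : 'M[k]_(m, n) := \matrix_(i, j) phi (dot (e i) (f j)).

Lemma pairing_mx_bilinear (x : 'rV_m) (j : 'I_n) :
  (x *m pairing_mx) 0 j = phi (dot (\sum_i x 0 i *: e i) (f j)).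
Proof.
rewrite dotC dot_comb linear_sum mxE; apply: eq_bigr => i _.
by rewrite linearZ mxE dotC.
Qed.

(** The basis [v] of I_s lifts to cycles [u i] with coefficients in degree s-1. A combination of
    them orthogonal to every 2-cycle satisfies X . y = 0 by [pairing_left_nondeg], which is a linear
    relation between the [v i]. *)
Lemma rank_pairing_ge : (s <= \rank pairing_mx)%N.
Proof.
have [Vv _ iv] := bv; have [Ce spe _] := be; have [Cf spf _] := bf.
have s1 : s.-1.+1 = s by rewrite prednK //; lia.
have lift_v i : exists y : vec, hom3 s.-1 y /\ v i = dot X y.
  have [hv Iv] := Vv i.
  have [y vy _] := ideal_dot_Xv s3 lowI Iv.
  exists (pihomog3 s.-1 y); split; first exact: hom3_pihomog3.
  by rewrite dot_Xv_pihomog3 s1 -vy pihomog_dE.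
have [u Hu] := fin_all_exists lift_v.
have Cu i : cyc1 I (u i) by rewrite /cyc1 -(Hu i).2; case: (Vv i).
have [C HC] := fin_all_exists (fun i => spe _ (Cu i)).
pose Cm := \matrix_(i, j) C i j.
suff fr : row_free (Cm *m pairing_mx) by rewrite -(eqP fr) mxrankM_maxr.
rewrite -kermx_eq0; apply/eqP/row_matrixP=> l; rewrite row0.
have := row_sub l (kermx (Cm *m pairing_mx)); move: (row l _) => z /sub_kermxP zC.
pose y := \sum_i z 0 i *: u i.
have bnd_y : bnd1 I (y - \sum_j (z *m Cm) 0 j *: e j).
  have -> : \sum_j (z *m Cm) 0 j *: e j = \sum_i z 0 i *: \sum_j C i j *: e j.
    under [RHS]eq_bigr do rewrite scaler_sumr.
    rewrite exchange_big; apply: eq_bigr => j _; rewrite mxE scaler_suml.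
    by apply: eq_bigr => i _; rewrite mxE scalerA.
  rewrite -sumrB; apply: (subspace_sum (subspace_bnd1 idI)) => i.
  by rewrite -scalerBr; apply: (subspaceZ (subspace_bnd1 idI)).
have Cy : cyc1 I y by apply: (subspace_comb (subspace_cyc1 idI)).
have yf j : phi (dot y (f j)) = 0.
  rewrite -(subrK (\sum_j (z *m Cm) 0 j *: e j) y) dotC dotDr linearD ![dot (f j) _]dotC /=.
  rewrite -pairing_mx_bilinear -mulmxA zC mxE addr0.
  exact: phiI (dot_bnd1_cyc2 idI bnd_y (Cf j)).
have yw w : cyc2 I w -> phi (dot y w) = 0.
  move=> Cw; have [c Hc] := spf w Cw.
  have Z := phiI (dot_cyc1_bnd2 idI Cy Hc).
  have -> : dot y w = dot y (w - \sum_i c i *: f i) + dot y (\sum_i c i *: f i).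
    by rewrite -dotDr subrK.
  rewrite linearD Z add0r dot_comb linear_sum big1 // => i _.
  by rewrite linearZ /= yf mulr0.
have hy : hom3 s.-1 y.
  move=> a; rewrite /y sum_ffunE; apply: (subspace_sum (subspace_homog k _)) => i.
  by rewrite ffunE; apply: dhomogZ; apply: (Hu i).1.
have := pairing_left_nondeg s3 idI homI pi_surj pi_ker phiI ideal_of_phi phi_nondeg hy
  (fun w _ => @yw w).
rewrite /y dot_comb => H; apply/rowP=> i; rewrite [RHS]mxE; apply: (iv (fun i => z 0 i)).
by rewrite -[RHS]H; apply: eq_bigr => i' _; rewrite (Hu i').2.
Qed.

Hypothesis me : forall i, middle s (e i).
Hypothesis mf : forall j, middle s (f j).

(* By degrees, only [T_{1,s} * T_{2,s+2}] and [T_{1,s+1} * T_{2,s+1}] contribute;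
   [dim T_{1,s} = s], and [T_{2,s+1}] is the space of linear syzygies. *)
Lemma rank_pairing_le : (\rank pairing_mx <= 2 * s - 1)%N.
Proof.
have [Vv _ iv] := bv; have [Ce _ ie] := be; have [Cf _ if_] := bf.
have s1 : (1 + s.-1)%N = s by rewrite add1n prednK //; lia.
have cls l (g : 'I_l -> vec) : (forall i, middle s (g i)) ->
    exists b : 'I_l -> bool, forall i, if b i then hom3 s.-1 (g i) else hom3 s (g i).
  move=> mg; suff H i : exists b : bool, if b then hom3 s.-1 (g i) else hom3 s (g i).
    exact: fin_all_exists H.
  by case: (mg i); [exists true | exists false].
have [a Ha] := cls _ _ me; have [b Hb] := cls _ _ mf.
(* [a] and [b] mark the basis elements with coefficients of degree s-1. In the rows outside [a] only
   the columns in [b] survive, because s + s is not the degree 2s-1 that [phi] reads; so the rank is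
   at most [#|a| + #|b|]. *)
pose B1 := \matrix_(i, j) (if a i then pairing_mx i j else 0).
pose B2 := \matrix_(i, j) (if a i then 0 else pairing_mx i j).
have -> : pairing_mx = B1 + B2.
  by apply/matrixP=> i j; rewrite !mxE; case: (a i); rewrite ?addr0 ?add0r.
apply: leq_trans (mxrank_add _ _) _.
have r1 : (\rank B1 <= #|a|)%N.
  apply: rank_rows_support => i /negPf ai; apply/rowP=> j.
  by rewrite !mxE ai.
have r2 : (\rank B2 <= #|b|)%N.
  rewrite -mxrank_tr; apply: rank_rows_support => j /negPf bj; apply/rowP=> i.
  rewrite !mxE; case: ifP => // ai; rewrite phiP.
  have := Ha i; have := Hb j; rewrite ai bj => hf he.
  by rewrite (pihomog_ne0 _ (dot_hom3 he hf)) ?linear0 //; lia.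
have ca : (#|a| <= s)%N.
  have Y0 : forall c : 'I_m -> k, \sum_i c i *: dot X (e i) = 0 -> forall i, c i = 0.
    move=> c; rewrite -dot_comb => /dot_Xv_eq0[w Ew]; apply: ie.
    by exists w; rewrite Ew subrr; apply: subspace0 (subspace_inI3 idI).
  have sV : subspace (fun p => p = 0 :> R).
    by split=> // t x y -> ->; rewrite scaler0 addr0.
  apply: (indep_mod_leq sV bv (c := fun l => dot X (e (enum_val l)))) => [l|z Hz].
    split; last exact: Ce.
    have := Ha (enum_val l); rewrite [a _](enum_valP l) => he.
    by rewrite -s1; apply: dot_hom3 (hom3_Xv k) he.
  exact: (subfamily_indep (W := fun p => p = 0) Y0).
have cb : (#|b| < s)%N.
  (* The generic point lives over the fraction field of R itself. *)
  pose tau : {rmorphism R -> {fraction R}} := @tofrac R.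
  pose iota : {rmorphism k -> {fraction R}} := (tau \o @mpolyC 3 k).
  apply: (@linear_syzygies_lt k s I s3 idI highI phi phiI phi_nondeg _ tau iota _ _ _
     (fun l => f (enum_val l)) v bv).
  - by move=> p; apply: tofrac_eq0.
  - by [].
  - by move=> l; have := Hb (enum_val l); rewrite [b _](enum_valP l).
  - by move=> l; apply: Cf.
  - move=> z Hz; apply: (subfamily_indep if_).
    have [p Ep] := cross_Xv_eq0 Hz; exists p; rewrite Ep subrr.
    exact: subspace0 (subspace_inI3 idI).
lia.
Qed.

End PairingRank.

(** * The exterior algebra in coordinates *)

Section Sets3.

Definition set3 (a b c : bool) : {set 'I_3} := [set i : 'I_3 | nth false [:: a; b; c] i].

Lemma in_set3 a b c :
  ((i0 \in set3 a b c) = a) * ((i1 \in set3 a b c) = b) * ((i2 \in set3 a b c) = c).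
Proof. by rewrite !inE. Qed.

Lemma set3P (S : {set 'I_3}) : S = set3 (i0 \in S) (i1 \in S) (i2 \in S).
Proof. by apply/setP; apply: ord3P; rewrite in_set3. Qed.

Lemma sum_set3 (V : nmodType) (F : {set 'I_3} -> V) :
  \sum_T F T = \sum_a \sum_b \sum_c F (set3 a b c).
Proof.
pose h (x : bool * (bool * bool)) := set3 x.1 x.2.1 x.2.2.
rewrite (reindex h) /=; last first.
  exists (fun S : {set 'I_3} => (i0 \in S, (i1 \in S, i2 \in S))) => [[a [b c]]|S] _.
    by rewrite /h !in_set3.
  by rewrite /h -set3P.
rewrite [RHS](eq_bigr (fun a => \sum_x F (set3 a x.1 x.2))) => [|a _].
  by rewrite pair_bigA.
by rewrite pair_bigA.
Qed.

Lemma card_pred3 (P : pred 'I_3) : #|[set j | P j]| = (P i0 + P i1 + P i2)%N.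
Proof.
rewrite -sum1_card (eq_bigl P); last by move=> j; rewrite inE.
by rewrite big_mkcond sum_ord3; do 3!case: (P _).
Qed.

Lemma card_set3 (S : {set 'I_3}) : #|S| = ((i0 \in S) + (i1 \in S) + (i2 \in S))%N.
Proof. by rewrite -card_pred3; apply: eq_card => i; rewrite inE. Qed.

Lemma subset3 (T S : {set 'I_3}) : (T \subset S) =
  [&& (i0 \in T) ==> (i0 \in S), (i1 \in T) ==> (i1 \in S) & (i2 \in T) ==> (i2 \in S)].
Proof.
apply/subsetP/and3P=> [sub|[/implyP H0 /implyP H1 /implyP H2]].
  by split; apply/implyP; apply: sub.
by apply: ord3P.
Qed.

Lemma inversions3 (T U : {set 'I_3}) : inversions T U =
  ((i1 \in T) && (i0 \in U) + ((i2 \in T) && (i0 \in U)) + ((i2 \in T) && (i1 \in U)))%N.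
Proof.
rewrite /inversions -sum1_card.
transitivity (\sum_(i : 'I_3) \sum_(j : 'I_3) [&& i \in T, j \in U & (j < i)%N])%N.
  rewrite pair_bigA big_mkcond; apply: eq_bigr => -[i j] _; rewrite inE /=.
  by case: ifP => _.
rewrite !sum_ord3 /= !andbF !andbT.
by do !case: (_ \in _).
Qed.

End Sets3.

Ltac cases3 S := case: (i0 \in S); case: (i1 \in S); case: (i2 \in S).

Section KoszulCoordinates.
Variable k : fieldType.
Local Notation R := {mpoly k[3]}.
Local Notation vec := {ffun 'I_3 -> R}.
Local Notation X := (Xv k).
Implicit Types u v w : vec.

Definition K1 u : koszul k := [ffun S : {set 'I_3} =>
  (match i0 \in S, i1 \in S, i2 \in S with
  | true, false, false => u i0 | false, true, false => u i1
  | false, false, true => u i2 | _, _, _ => 0 end : R)].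

(* The sign makes products and differentials of coordinates the usual ones. *)
Definition K2 w : koszul k := [ffun S : {set 'I_3} =>
  (match i0 \in S, i1 \in S, i2 \in S with
  | false, true, true => w i0 | true, false, true => - w i1
  | true, true, false => w i2 | _, _, _ => 0 end : R)].

Definition K3 (p : R) : koszul k := [ffun S : {set 'I_3} =>
  (match i0 \in S, i1 \in S, i2 \in S with true, true, true => p | _, _, _ => 0 end : R)].

Lemma K1_is_linear : linear K1.
Proof.
move=> a u v; apply/ffunP=> S; rewrite !ffunE.
by cases3 S; rewrite ?scaler0 ?addr0.
Qed.
HB.instance Definition _ :=
  GRing.isLinear.Build k vec (koszul k) _ K1 K1_is_linear.

Lemma K2_is_linear : linear K2.
Proof.
move=> a u v; apply/ffunP=> S; rewrite !ffunE.
by cases3 S; rewrite ?scaler0 ?addr0 // opprD scalerN.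
Qed.
HB.instance Definition _ :=
  GRing.isLinear.Build k vec (koszul k) _ K2 K2_is_linear.

Lemma K3_is_linear : linear K3.
Proof.
move=> a u v; apply/ffunP=> S; rewrite !ffunE.
by cases3 S; rewrite ?scaler0 ?addr0.
Qed.
HB.instance Definition _ :=
  GRing.isLinear.Build k R (koszul k) _ K3 K3_is_linear.

Lemma koszul_deg1 u : koszul_deg 1 (K1 u).
Proof. by move=> S; rewrite card_set3 ffunE; cases3 S. Qed.

Lemma koszul_deg2 u : koszul_deg 2 (K2 u).
Proof. by move=> S; rewrite card_set3 ffunE; cases3 S. Qed.

Lemma koszul_deg3 p : koszul_deg 3 (K3 p).
Proof. by move=> S; rewrite card_set3 ffunE; cases3 S. Qed.

Lemma koszul_deg1P (u : koszul k) : koszul_deg 1 u -> exists v, u = K1 v.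
Proof.
move=> Hu; exists (vec3 (u (set3 true false false)) (u (set3 false true false))
  (u (set3 false false true))).
apply/ffunP=> S; rewrite ffunE !vec3E (set3P S) !in_set3.
by cases3 S => //; rewrite Hu // card_set3 !in_set3.
Qed.

Lemma koszul_deg2P (u : koszul k) : koszul_deg 2 u -> exists v, u = K2 v.
Proof.
move=> Hu; exists (vec3 (u (set3 false true true)) (- u (set3 true false true))
  (u (set3 true true false))).
apply/ffunP=> S; rewrite ffunE !vec3E opprK (set3P S) !in_set3.
by cases3 S => //; rewrite Hu // card_set3 !in_set3.
Qed.

Lemma koszul_deg3P (u : koszul k) : koszul_deg 3 u -> exists p, u = K3 p.
Proof.
move=> Hu; exists (u (set3 true true true)).
apply/ffunP=> S; rewrite ffunE (set3P S) !in_set3.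
by cases3 S => //; rewrite Hu // card_set3 !in_set3.
Qed.

Lemma koszul_deg4P (u : koszul k) : koszul_deg 4 u -> u = 0.
Proof.
move=> Hu; apply/ffunP=> S; rewrite Hu ?ffunE // card_set3.
by cases3 S.
Qed.

Lemma koszul_dE (u : koszul k) (a b c : bool) : koszul_d u (set3 a b c) =
  (if a then 0 else 'X_i0 * u (set3 true b c)) +
  (if b then 0 else (-1) ^+ a * 'X_i1 * u (set3 a true c)) +
  (if c then 0 else (-1) ^+ (a + b) * 'X_i2 * u (set3 a b true)).
Proof.
rewrite ffunE big_mkcond sum_ord3 !in_set3 !card_pred3 !in_set3 /= !andbF !andbT !addn0.
have -> : i0 |: set3 a b c = set3 true b c.
  by apply/setP; apply: ord3P; rewrite !inE.
have -> : i1 |: set3 a b c = set3 a true c.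
  by apply/setP; apply: ord3P; rewrite !inE.
have -> : i2 |: set3 a b c = set3 a b true.
  by apply/setP; apply: ord3P; rewrite !inE.
by case: a; case: b; case: c; rewrite ?expr0 ?mul1r.
Qed.

Lemma koszul_d_K1 u S : koszul_d (K1 u) S = if S == set0 then dot X u else 0.
Proof.
rewrite (set3P S) koszul_dE /K1 !ffunE !in_set3.
have -> : (set3 (i0 \in S) (i1 \in S) (i2 \in S) == set0) =
    [&& i0 \notin S, i1 \notin S & i2 \notin S].
  by rewrite -set3P -cards_eq0 card_set3 !addn_eq0; cases3 S.
rewrite /dot !XvE.
by cases3 S => /=; rewrite ?mulr0 ?addr0 ?expr0 ?mul1r.
Qed.

Lemma koszul_d_K2 w : koszul_d (K2 w) = K1 (- cross X w).
Proof.
apply/ffunP=> S; rewrite (set3P S) koszul_dE /K1 /K2 !ffunE !in_set3.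
by cases3 S => /=; ring.
Qed.

Lemma koszul_d_K3 p : koszul_d (K3 p) = K2 (scale3 p X).
Proof.
apply/ffunP=> S; rewrite (set3P S) koszul_dE /K3 /K2 !ffunE !in_set3.
by cases3 S => /=; ring.
Qed.

Lemma koszul_mulE (u v : koszul k) S : koszul_mul u v S =
  \sum_a \sum_b \sum_c if set3 a b c \subset S then
    (-1) ^+ inversions (set3 a b c) (S :\: set3 a b c) * u (set3 a b c) *
      v (S :\: set3 a b c) else 0.
Proof. by rewrite ffunE big_mkcond sum_set3. Qed.

Lemma K1_K1 u v : koszul_mul (K1 u) (K1 v) = K2 (cross u v).
Proof.
apply/ffunP=> S; rewrite koszul_mulE !big_bool !subset3 !inversions3 /cross.
rewrite !ffunE !inE /=.
by cases3 S => /=; ring.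
Qed.

Lemma K1_K2 u w : koszul_mul (K1 u) (K2 w) = K3 (dot u w).
Proof.
apply/ffunP=> S; rewrite koszul_mulE !big_bool !subset3 !inversions3 /dot.
rewrite !ffunE !inE /=.
by cases3 S => /=; ring.
Qed.

Lemma K2_K1 u w : koszul_mul (K2 w) (K1 u) = K3 (dot u w).
Proof.
apply/ffunP=> S; rewrite koszul_mulE !big_bool !subset3 !inversions3 /dot.
rewrite !ffunE !inE /=.
by cases3 S => /=; ring.
Qed.

End KoszulCoordinates.

(** * Tor of R/I in vector coordinates *)

Section TorTranslation.
Variables (k : fieldType) (I : {pred {mpoly k[3]}}).
Hypothesis idI : idealr_closed I.
Local Notation R := {mpoly k[3]}.
Local Notation vec := {ffun 'I_3 -> R}.
Local Notation X := (Xv k).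
Implicit Types u w : vec.

Lemma K1_ideal u : (forall S, K1 u S \in I) <-> inI3 I u.
Proof.
have I0 := ideal0 idI; split=> [H|H S]; last by rewrite ffunE; cases3 S.
by apply: ord3P; [have := H (set3 true false false) | have := H (set3 false true false)
  | have := H (set3 false false true)]; rewrite ffunE !in_set3.
Qed.

Lemma K2_ideal u : (forall S, K2 u S \in I) <-> inI3 I u.
Proof.
have I0 := ideal0 idI; split=> [H|H S].
  apply: ord3P; [have := H (set3 false true true) | have := H (set3 true false true)
    | have := H (set3 true true false)]; rewrite ffunE !in_set3 //.
  by move/(idealN idI); rewrite opprK.
by rewrite ffunE; cases3 S => //; apply: idealN.
Qed.

Lemma K3_ideal p : (forall S, K3 p S \in I) <-> p \in I.
Proof.
have I0 := ideal0 idI; split=> [H|H S]; last by rewrite ffunE; cases3 S.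
by have := H (set3 true true true); rewrite ffunE !in_set3.
Qed.

Lemma tor_cycle1 u : tor_cycle I 1 (K1 u) <-> cyc1 I u.
Proof.
split=> [[_ /(_ set0)]|Cu]; first by rewrite koszul_d_K1 eqxx.
split=> [|S]; first exact: koszul_deg1.
by rewrite koszul_d_K1; case: eqP => // _; apply: ideal0.
Qed.

Lemma tor_cycle2 w : tor_cycle I 2 (K2 w) <-> cyc2 I w.
Proof.
have E : cyc2 I w <-> forall S, koszul_d (K2 w) S \in I.
  have N i : (- cross X w) i = - cross X w i by rewrite [LHS]ffunE.
  rewrite koszul_d_K2 K1_ideal; split=> H i; have := H i; rewrite N => /(idealN idI) //.
  by rewrite opprK.
by rewrite E; split=> [[]|] // H; split=> //; apply: koszul_deg2.
Qed.

Lemma tor_cycle3 p : tor_cycle I 3 (K3 p) <-> in_socle I p.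
Proof.
have E : in_socle I p <-> forall S, koszul_d (K3 p) S \in I.
  rewrite koszul_d_K3 K2_ideal (in_socleXP idI).
  by split=> H i; have := H i; rewrite ffunE XvE mulrC.
by rewrite E; split=> [[]|] // H; split=> //; apply: koszul_deg3.
Qed.

Lemma tor_boundary1 u : tor_boundary I 1 (K1 u) <-> bnd1 I u.
Proof.
have E w : (forall S, (K1 u - koszul_d (K2 w)) S \in I) <-> inI3 I (u - cross X (- w)).
  rewrite koszul_d_K2 -linearB K1_ideal; suff -> : cross X (- w) = - cross X w by [].
  by rewrite -[- w]sub0r crossBr cross0 sub0r.
split=> [[_ [v [/koszul_deg2P[w ->] /E H]]]|[w Hw]]; first by exists (- w).
split; first exact: koszul_deg1.
by exists (K2 (- w)); split; [apply: koszul_deg2 | apply/E; rewrite opprK].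
Qed.

Lemma tor_boundary2 w : tor_boundary I 2 (K2 w) <-> bnd2 I w.
Proof.
have E p : (forall S, (K2 w - koszul_d (K3 p)) S \in I) <-> inI3 I (w - scale3 p X).
  by rewrite koszul_d_K3 -linearB K2_ideal.
split=> [[_ [v [/koszul_deg3P[p ->] /E H]]]|[p Hp]]; first by exists p.
split; first exact: koszul_deg2.
by exists (K3 p); split; [apply: koszul_deg3 | apply/E].
Qed.

Lemma tor_boundary3 p : tor_boundary I 3 (K3 p) <-> p \in I.
Proof.
have d0 : koszul_d (0 : koszul k) = 0.
  apply/ffunP=> S; rewrite !ffunE big1 // => i _.
  by rewrite ffunE mulr0.
split=> [[_ [v [/koszul_deg4P -> H]]]|Ip].
  by apply/K3_ideal => S; have := H S; rewrite d0 subr0.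
split; first exact: koszul_deg3.
exists 0; split=> [S _|S]; first by rewrite ffunE.
rewrite d0 subr0; exact: (K3_ideal p).2 Ip S.
Qed.

Lemma tor_basis1 n (b : 'I_n -> vec) :
  basis_mod (cyc1 I) (bnd1 I) b -> tor_basis I 1 (fun i => K1 (b i)).
Proof.
move=> bb; apply: (@basis_mod_transport k vec (koszul k) (K1 (k := k))).
  by move=> v [/koszul_deg1P].
by apply: eq_basis_mod bb => u; split=> /=; rewrite ?tor_cycle1 ?tor_boundary1.
Qed.

Lemma tor_basis2 n (b : 'I_n -> vec) :
  basis_mod (cyc2 I) (bnd2 I) b -> tor_basis I 2 (fun i => K2 (b i)).
Proof.
move=> bb; apply: (@basis_mod_transport k vec (koszul k) (K2 (k := k))).
  by move=> v [/koszul_deg2P].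
by apply: eq_basis_mod bb => u; split=> /=; rewrite ?tor_cycle2 ?tor_boundary2.
Qed.

Lemma tor_basis3 n (b : 'I_n -> R) :
  basis_mod (in_socle I) (fun p => p \in I) b -> tor_basis I 3 (fun i => K3 (b i)).
Proof.
move=> bb; apply: (@basis_mod_transport k R (koszul k) (K3 (k := k))).
  by move=> v [/koszul_deg3P].
by apply: eq_basis_mod bb => u; split=> /=; rewrite ?tor_cycle3 ?tor_boundary3.
Qed.

End TorTranslation.

Lemma in_Rplus2_ord_ge (k : fieldType) (p : {mpoly k[3]}) : ord_ge 2 p -> in_Rplus2 p.
Proof.
move=> Hp; have p0 : p@_0%MM = 0 by apply: Hp; rewrite mdeg0.
have [u pu] := Rplus_decomp p0.
(* Dropping the constant terms of [u] leaves X . u unchanged, because [p] has no linear part. *)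
pose u' := u - trunc3 1 u.
exists 3, (fun i => 'X_i), u'; split=> [i|].
  split; first by rewrite /in_Rplus mcoeffX mnm1_eq0.
  by apply: ge3_subtrunc; rewrite mdeg0.
rewrite sum_ord3; transitivity (dot (Xv k) u'); last by rewrite /dot !XvE.
by rewrite dotBr dot_Xv_trunc3 -pu trunc_ord_ge // subr0.
Qed.

(** * Normal form of the pairing and proof of the theorem *)

Section Diagonalization.
Variables (k : fieldType) (s : nat) (I : {pred {mpoly k[3]}}).
Hypotheses (idI : idealr_closed I).
Local Notation vec := {ffun 'I_3 -> {mpoly k[3]}}.
Variables (m n : nat) (e : 'I_m -> vec) (f : 'I_n -> vec) (phi : {scalar {mpoly k[3]}}).
Hypotheses (be : basis_mod (cyc1 I) (bnd1 I) e) (bf : basis_mod (cyc2 I) (bnd2 I) f).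
Hypotheses (me : forall i, ge3 s (e i)) (mf : forall j, ge3 s (f j)).

(** The inverses of the two factors around [pid_mx] in the Gaussian elimination of the pairing
    matrix serve as base changes. They mix the two middle degrees, so only the lower bound on the
    order survives, which is all that the product computations use. *)
Lemma diagonal_bases : exists (e' : 'I_m -> vec) (f' : 'I_n -> vec),
  [/\ basis_mod (cyc1 I) (bnd1 I) e', basis_mod (cyc2 I) (bnd2 I) f',
      forall i, ge3 s (e' i), forall j, ge3 s (f' j)
    & forall i j, phi (dot (e' i) (f' j)) =
        ((i == j :> nat) && (i < \rank (pairing_mx phi e f))%N)%:R].
Proof.
set B := pairing_mx phi e f.
pose L := invmx (col_ebase B); pose U := (invmx (row_ebase B))^T.
have uL : L \in unitmx by rewrite unitmx_inv col_ebase_unit.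
have uU : U \in unitmx by rewrite unitmx_tr unitmx_inv row_ebase_unit.
exists (fun i => \sum_j L i j *: e j), (fun i => \sum_j U i j *: f j); split.
- by apply: basis_mod_change => //; apply: subspace_cyc1.
- by apply: basis_mod_change => //; apply: subspace_cyc2.
- by move=> i; apply: (subspace_comb (@subspace_ge3 k s)).
- by move=> i; apply: (subspace_comb (@subspace_ge3 k s)).
move=> i j.
have -> : ((i == j :> nat) && (i < \rank B)%N)%:R = (pid_mx (\rank B) : 'M[k]_(m, n)) i j.
  by rewrite mxE.
have <- : L *m B *m U^T = pid_mx (\rank B).
  rewrite /L /U trmxK -{2}(mulmx_ebase B) !mulmxA mulVmx ?col_ebase_unit // mul1mx.
  by rewrite -mulmxA mulmxV ?row_ebase_unit // mulmx1.
rewrite mxE dot_comb linear_sum; apply: eq_bigr => l _.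
rewrite linearZ /= [U^T _ _]mxE mulrC; congr (_ * _).
rewrite dotC dot_comb linear_sum mxE; apply: eq_bigr => i' _.
by rewrite linearZ /= !mxE dotC.
Qed.

End Diagonalization.

Theorem corollary8p5 (k : fieldType) (s : nat) (I : {pred {mpoly k[3]}}) :
  (3 <= s)%N ->
  idealr_closed I ->
  homogeneous_ideal I ->
  has_grade I 3 ->
  compressed I (2 * s - 1) ->
  socle_iso I [:: s; (2 * s - 1)%N] ->
  exists r : nat, (s <= r <= 2 * s - 1)%N /\ tor_class_G I r.
Proof.
move=> s3 idI homI _ compI [b [hb bb]].
pose b0 := b (@Ordinal 2 0 isT); pose b1 := b (@Ordinal 2 1 isT).
have sumb (c : 'I_2 -> k) : \sum_i c i *: b i = c ord0 *: b0 + c ord_max *: b1.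
  rewrite !big_ord_recl big_ord0 addr0.
  by congr (c _ *: b _ + c _ *: b _); apply: val_inj.
have hb0 : b0 \is s.-homog := hb (@Ordinal 2 0 isT).
have hb1 : b1 \is (2 * s - 1).-homog := hb (@Ordinal 2 1 isT).
have [sb spb ib] := bb.
have sb0 : in_socle I b0 := sb _; have sb1 : in_socle I b1 := sb _.
have soc_span p : in_socle I p -> exists c0 c1, p - (c0 *: b0 + c1 *: b1) \in I.
  by move=> /spb[c Hc]; exists (c ord0), (c ord_max); rewrite -sumb.
have soc_indep c0 c1 : c0 *: b0 + c1 *: b1 \in I -> c0 = 0 /\ c1 = 0.
  move=> H; pose c (i : 'I_2) := if i == ord0 then c0 else c1.
  have := ib c; rewrite (sumb c) => /(_ H) z.
  by split; [exact: (z ord0) | exact: (z ord_max)].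
have lowI : forall p, p \in I -> ord_ge s p by eapply ideal_ord_ge; eassumption.
have highI : forall p, ord_ge (2 * s) p -> p \in I by eapply ord_ge_ideal; eassumption.
have hil : has_hilb I s (1 + 'C(s + 1, 2)) by eapply hilb_s; eassumption.
have [v bv] : exists v : 'I_s -> {mpoly k[3]},
    basis_mod (fun p => p \is s.-homog /\ p \in I) (fun p => p = 0) v.
  by eapply ideal_s_basis; eassumption.
have b1I : b1 \notin I by eapply b1_notin; eassumption.
have [N [pi [pi_surj pi_ker]]] := quotient_coords idI highI.
have [phi [phiI phiP phib1]] : exists phi : {scalar {mpoly k[3]}},
    [/\ forall p, p \in I -> phi p = 0,
      forall p, phi p = phi (pihomog mdeg (2 * s - 1) p) & phi b1 = 1].
  by eapply exists_dual_functional; eassumption.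
have faithful p : ord_ge s.+1 p -> (forall c, phi (p * c) = 0) -> p \in I.
  by eapply ideal_of_phi; eassumption.
have nondeg c : (forall p, ord_ge s p -> phi (c * p) = 0) -> ord_ge s c.
  by eapply phi_nondeg; eassumption.
have decomp1 u : cyc1 I u -> exists h h',
    [/\ cyc1 I h /\ middle s h, cyc1 I h' /\ middle s h' & bnd1 I (u - (h + h'))].
  by eapply cyc1_decomp; eassumption.
have decomp2 u : cyc2 I u -> exists h h',
    [/\ cyc2 I h /\ middle s h, cyc2 I h' /\ middle s h' & bnd2 I (u - (h + h'))].
  by eapply cyc2_decomp; eassumption.
have [m [e [f [He Hf be bf]]]] : exists m
    (e : 'I_m -> {ffun 'I_3 -> {mpoly k[3]}})
    (f : 'I_(m + 2 - 1) -> {ffun 'I_3 -> {mpoly k[3]}}),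
    [/\ forall i, cyc1 I (e i) /\ middle s (e i),
        forall j, cyc2 I (f j) /\ middle s (f j),
        basis_mod (cyc1 I) (bnd1 I) e & basis_mod (cyc2 I) (bnd2 I) f].
  by apply: (tor_bases s3 idI lowI sb0 sb1 soc_span soc_indep pi_surj pi_ker
       _ _ decomp1 decomp2) => u [].
have me i : middle s (e i) := (He i).2; have mf j : middle s (f j) := (Hf j).2.
pose r := \rank (pairing_mx phi e f).
have r_ge : (s <= r)%N by eapply rank_pairing_ge; eassumption.
have r_le : (r <= 2 * s - 1)%N by eapply rank_pairing_le; eassumption.
have [e' [f' [be' bf' ge' gf' dual]]] := diagonal_bases idI phi be bf
  (fun i => middle_ge3 (me i)) (fun j => middle_ge3 (mf j)).
have [Ce' _ _] := be'; have [Cf' _ _] := bf'.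
exists r; split; first by rewrite r_ge.
split; first by lia.
  by move=> p /lowI Hp; apply: in_Rplus2_ord_ge; apply: ord_geW Hp; lia.
(* The socle basis is listed in reverse: class G(r) wants the common value of the nonzero products,
   here the top socle element, in first position. *)
pose g (i : 'I_2) := if i == ord0 then b1 else b0.
have bg : basis_mod (in_socle I) (fun p => p \in I) g.
  have sumg (c : 'I_2 -> k) : \sum_i c i *: g i = c ord_max *: b0 + c ord0 *: b1.
    rewrite !big_ord_recl big_ord0 addr0 addrC /g /=.
    by congr (c _ *: _ + _); apply: val_inj.
  split=> [i|p /soc_span[c0 [c1 H]]|c].
  - by rewrite /g; case: ifP.
  - by exists (fun i => if i == ord0 then c1 else c0); rewrite sumg.
  - rewrite sumg => /soc_indep[z0 z1] i.
    have [->|/eqP ni] := i =P ord0; first by [].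
    suff -> : i = ord_max by [].
    by apply: val_inj; case: i ni => [[|[|]]].
exists m, 2%N, (fun i => K1 (e' i)), (fun j => K2 (f' j)), (fun i => K3 (g i)), ord0.
have rm : (r <= m)%N := rank_leq_row _.
have rn : (r <= m + 2 - 1)%N := rank_leq_col _.
have mgens : min_num_gens I m := min_num_gens_tor s3 idI homI lowI be me.
split.
- by split=> //; exists g.
- by split; [apply: tor_basis1 | apply: tor_basis2 | apply: tor_basis3].
- move=> i j; rewrite /tor_eq subr0 K1_K1; apply/(tor_boundary2 idI).
  exact: (cross_cyc1_bnd s3 idI highI pi_surj pi_ker phiI faithful nondeg
            (Ce' i) (Ce' j) (ge' i) (ge' j)).
move=> i j /=; rewrite /tor_eq K1_K2 K2_K1.
(* The product of two cycles is a socle element of order at least 2(s-1) >= s+1, hence congruent to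
   its value under [phi] times [b1]; the diagonal form gives that value. *)
suff -> : (if (i == j :> nat) && (i < r)%N then K3 (g ord0) else 0) =
    K3 (phi (dot (e' i) (f' j)) *: b1).
  rewrite -linearB; split; apply/(tor_boundary3 idI);
  (eapply soc_high; try eassumption; [|exact: dot_cyc_socle]);
  by apply: ord_geW (dot_ge3 (ge' i) (gf' j)); lia.
rewrite dual /g eqxx -/r; case: ifP => _; first by rewrite scale1r.
by rewrite scale0r linear0.
Qed.
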